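(* Consider the PPDS iteration described in the context and assume: (1) each $f_i$ is convex and $L$-smooth (differentiable with $L$-Lipschitz gradient), and $f$ is $\mu$-strongly convex with $\mu>0$; let $x^\star$ be the unique minimizer of $f$; (2) the triples $(V_t,A_t,B_t)_{t\ge1}$ are independent and identically distributed over $t$; (3) for all $t\ge1$, both $A_t$ and $B_t$ are doubly stochastic, and $$\lambda:=\max\big(\sigma(\mathbb{E}[A_1^\top(I-J)A_1]),\ \sigma(\mathbb{E}[B_1^\top(I-J)B_1])\big)<1;$$ (4) $V_t$ has fixed size $m$ ($1\le m\le n$) and is sampled uniformly from all subsets of $V$ of this size. If the step-size satisfies $$0<\eta\le\min\left(\frac{(1-\lambda)^2}{14L}\sqrt{\frac nm},\ \frac{(1-\lambda)^2}{2304L}\left(\frac nm\right)^{3/2},\ \frac1{576L}\sqrt{\frac nm}\right),$$ then for every node $i\in V$ the expected squared distance $\mathbb{E}[\|x_{i,t}-x^\star\|^2]$ vanishes geometrically in $O(\rho^t)$ (with a constant independent of $t$), where $$\rho=\max\left(1-\frac{\eta\mu m}{2n},\ 1-\frac{m}{4n}\right).$$ In particular, for a suitable choice of $\eta$ satisfying the condition above, the number of iterations needed to achieve $\mathbb{E}[\|x_{i,t}-x^\star\|^2]\le\varepsilon$ is $$O\left(\left(\frac L\mu\sqrt{\frac nm}\,\frac1{(1-\lambda)^2}+\frac nm\right)\log\frac1\varepsilon\right)\quad\text{as }\varepsilon\to0,$$ where the constant hidden in $O(\cdot)$ is universal.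
   Context: Setting. There are $n$ nodes, indexed by $V=\{1,\dots,n\}$, and functions $f_i:\mathbb{R}^d\to\mathbb{R}$, $i\in V$; put $f=\frac1n\sum_{i=1}^n f_i$. For a matrix $X\in\mathbb{R}^{n\times d}$ with rows $x_1,\dots,x_n$, $\nabla F(X)\in\mathbb{R}^{n\times d}$ denotes the matrix whose $i$-th row is $\nabla f_i(x_i)$. $(V_t)_{t\ge1}$ is a sequence of random subsets of $V$ (the active nodes), and $(A_t)_{t\ge1}$, $(B_t)_{t\ge1}$ are sequences of random $n\times n$ matrices with non-negative entries, compatible with a fixed directed communication graph $(V,E)$, meaning that their $(i,j)$ entry is $0$ whenever $(j,i)\notin E$. $D_t=\mathrm{diag}(\mathbf 1_{i\in V_t})$ is the diagonal matrix whose $i$-th diagonal element is $1$ if $i\in V_t$ and $0$ otherwise. PPDS iteration. Given a fixed (deterministic) initial $X_1\in\mathbb{R}^{n\times d}$ and a step-size $\eta>0$, set $C_1=X_1$, $Y_1=\nabla F(X_1)$, and for $t\ge1$ $$Y_{t+1/2}=Y_t+D_t(\nabla F(X_t)-\nabla F(C_t)),\quad X_{t+1/2}=X_t-\eta D_tY_{t+1/2},\quad C_{t+1}=D_tX_t+(I-D_t)C_t,$$ $$Y_{t+1}=B_tY_{t+1/2},\quad X_{t+1}=A_tX_{t+1/2}.$$ The $i$-th row of $X_t$ is denoted $x_{i,t}$. Conventions: $\sigma(P)$ is the spectral radius of $P$; $\mathbf 1$ is the all-ones vector of size $n$ and $J=\mathbf 1\mathbf 1^\top/n$; a non-negative matrix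 $P$ is doubly stochastic if $P\mathbf 1=\mathbf 1$ and $\mathbf 1^\top P=\mathbf 1^\top$. *)

(* Defs.v *)
From HB Require Import structures.
From mathcomp Require Import all_boot all_order all_algebra.
From mathcomp Require Import complex.
From mathcomp Require Import all_classical all_reals all_analysis.

Set Implicit Arguments.
Unset Strict Implicit.
Unset Printing Implicit Defensive.

Import Order.TTheory GRing.Theory Num.Theory.
Import numFieldNormedType.Exports.

Local Open Scope classical_set_scope.
Local Open Scope ring_scope.
Local Open Scope convex_scope.

(* The library norm of ['rV[R]_d] is the sup norm: it is used only for the
   topology and differentiability, which do not depend on the norm. *)
Definition norm2 {R : realType} {d : nat} (x : 'rV[R]_d) : R :=
  Num.sqrt (\sum_(j < d) x ord0 j ^+ 2).

Definition gradient {R : realType} {d : nat} (f : 'rV[R]_d -> R)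
    (x : 'rV[R]_d) : 'rV[R]_d :=
  \row_(j < d) 'D_(delta_mx ord0 j) f x.

Definition smooth {R : realType} {d : nat} (L : R) (f : 'rV[R]_d -> R) : Prop :=
  (forall x, differentiable f x) /\
  (forall x y, norm2 (gradient f x - gradient f y) <= L * norm2 (x - y)).

Definition convex {R : realType} {d : nat} (f : 'rV[R]_d -> R) : Prop :=
  convex_function [set: convex_lmodType 'rV[R]_d] f.

Definition strongly_convex {R : realType} {d : nat} (mu : R)
    (f : 'rV[R]_d -> R) : Prop :=
  forall (t : {i01 R}) (x y : convex_lmodType 'rV[R]_d),
    f (x <| t |> y) <= ((f x : R^o) <| t |> (f y : R^o))
      - mu / 2 * (t%:num * (1 - t%:num)) * norm2 ((x : 'rV[R]_d) - y) ^+ 2.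

Definition average {R : realType} {n d : nat} (f : 'I_n -> 'rV[R]_d -> R)
    (x : 'rV[R]_d) : R :=
  n%:R^-1 * \sum_(i < n) f i x.

Definition minimizer {R : realType} {d : nat} (f : 'rV[R]_d -> R)
    (x : 'rV[R]_d) : Prop :=
  forall y, f x <= f y.

Definition averaging_mx {R : realType} {n : nat} : 'M[R]_n :=
  const_mx n%:R^-1.

Definition doubly_stochastic {R : realType} {n : nat} (M : 'M[R]_n) : Prop :=
  [/\ forall i j, 0 <= M i j,
      M *m (const_mx 1 : 'cV[R]_n) = const_mx 1 &
      (const_mx 1 : 'rV[R]_n) *m M = const_mx 1].

(* [e j i] means that (j, i) is an edge. *)
Definition compatible {R : realType} {n : nat} (e : rel 'I_n) (M : 'M[R]_n) : Prop :=
  forall i j, ~~ e j i -> M i j = 0.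

(* The eigenvalues are the complex ones; for n > 0 the supremum is a maximum. *)
Definition spectral_radius {R : realType} {n : nat} (M : 'M[R]_n) : R :=
  sup [set r : R | exists z : R[i],
    eigenvalue (map_mx (real_complex R) M) z /\ r = Normc.normc z].

HB.instance Definition _ (T : finType) := isPointed.Build {set T} finset.set0.
HB.instance Definition _ (T : finType) :=
  @isMeasurable.Build default_measure_display {set T}
    discrete_measurable discrete_measurable0
    discrete_measurableC discrete_measurableU.

(* Matrices carry the sigma-algebra generated by their entries, i.e. the Borel
   sigma-algebra of R^(p * q). *)
Definition mx_entry_events {R : realType} {p q : nat} : set (set 'M[R]_(p, q)) :=
  [set E | exists (i : 'I_p) (j : 'I_q) (U : set R),
     measurable U /\ E = [set M : 'M[R]_(p, q) | U (M i j)]].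

HB.instance Definition _ (R : realType) (p q : nat) :=
  @isMeasurable.Build (sigma_display (@mx_entry_events R p q)) 'M[R]_(p, q)
    <<s mx_entry_events >> (@sigma_algebra0 _ setT mx_entry_events)
    (@sigma_algebraC _ mx_entry_events)
    (@sigma_algebra_bigcup _ setT mx_entry_events).

Definition mutually_independent {R : realType} {d d' : measure_display}
    {T : measurableType d} {T' : measurableType d'} (P : probability T R)
    (I : eqType) (Z : I -> T -> T') : Prop :=
  forall (s : seq I) (E : I -> set T'),
    uniq s -> (forall i, measurable (E i)) ->
    P (\big[setI/setT]_(i <- s) (Z i @^-1` E i)) =
    (\prod_(i <- s) P (Z i @^-1` E i))%E.

Definition identically_distributed {R : realType} {d d' : measure_display}
    {T : measurableType d} {T' : measurableType d'} (P : probability T R)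
    (I : eqType) (Z : I -> T -> T') : Prop :=
  forall (i j : I) (E : set T'), measurable E ->
    pushforward P (Z i) E = pushforward P (Z j) E.

Definition iid {R : realType} {d d' : measure_display}
    {T : measurableType d} {T' : measurableType d'} (P : probability T R)
    (I : eqType) (Z : I -> T -> T') : Prop :=
  mutually_independent P Z /\ identically_distributed P Z.

Definition uniform_subset {R : realType} {d : measure_display}
    {T : measurableType d} (P : probability T R) {n : nat} (m : nat)
    (V : T -> {set 'I_n}) : Prop :=
  forall S : {set 'I_n},
    P [set w | V w = S] = (if #|S| == m then 'C(n, m)%:R^-1 else 0)%:E.

Definition expectation_mx {R : realType} {d : measure_display}
    {T : measurableType d} (P : probability T R) {p q : nat}
    (M : T -> 'M[R]_(p, q)) : 'M[R]_(p, q) :=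
  \matrix_(i < p, j < q) fine 'E_P[fun w => M w i j].

Definition mixing {R : realType} {d : measure_display}
    {T : measurableType d} (P : probability T R) {n : nat}
    (M : T -> 'M[R]_n) : R :=
  spectral_radius
    (expectation_mx P (fun w => (M w)^T *m (1%:M - averaging_mx) *m M w)).

Record ppds_state (R : realType) (n d : nat) := PPDSState {
  st_X : 'M[R]_(n, d);
  st_Y : 'M[R]_(n, d);
  st_C : 'M[R]_(n, d)
}.

Definition gradientF {R : realType} {n d : nat} (f : 'I_n -> 'rV[R]_d -> R)
    (X : 'M[R]_(n, d)) : 'M[R]_(n, d) :=
  \matrix_(i < n) gradient (f i) (row i X).

Definition active_mx {R : realType} {n : nat} (V : {set 'I_n}) : 'M[R]_n :=
  diag_mx (\row_(i < n) (i \in V)%:R).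

Definition ppds_step {R : realType} {n d : nat} (f : 'I_n -> 'rV[R]_d -> R)
    (eta : R) (V : {set 'I_n}) (A B : 'M[R]_n) (s : ppds_state R n d) :
    ppds_state R n d :=
  let D := active_mx V in
  let Yhalf := st_Y s + D *m (gradientF f (st_X s) - gradientF f (st_C s)) in
  let Xhalf := st_X s - eta *: (D *m Yhalf) in
  PPDSState (A *m Xhalf) (B *m Yhalf) (D *m st_X s + (1%:M - D) *m st_C s).

(* [ppds_run ... k] is the state after k steps, i.e. at time k + 1. *)
Fixpoint ppds_run {R : realType} {n d : nat} (f : 'I_n -> 'rV[R]_d -> R)
    (eta : R) (X1 : 'M[R]_(n, d)) (V : nat -> {set 'I_n})
    (A B : nat -> 'M[R]_n) (k : nat) : ppds_state R n d :=
  if k is k'.+1 then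
    ppds_step f eta (V k) (A k) (B k) (ppds_run f eta X1 V A B k')
  else PPDSState X1 (gradientF f X1) X1.

(* X_t for t >= 1; the values V_0, A_0, B_0 are never used. *)
Definition ppds_X {R : realType} {n d : nat} (f : 'I_n -> 'rV[R]_d -> R)
    (eta : R) (X1 : 'M[R]_(n, d)) (V : nat -> {set 'I_n})
    (A B : nat -> 'M[R]_n) (t : nat) : 'M[R]_(n, d) :=
  st_X (ppds_run f eta X1 V A B t.-1).

Definition ppds_error {R : realType} {dsp : measure_display}
    {Omega : measurableType dsp} (P : probability Omega R) {n d : nat}
    (f : 'I_n -> 'rV[R]_d -> R) (eta : R) (X1 : 'M[R]_(n, d))
    (V : nat -> Omega -> {set 'I_n}) (A B : nat -> Omega -> 'M[R]_n)
    (xstar : 'rV[R]_d) (i : 'I_n) (t : nat) : \bar R :=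
  'E_P[fun w => norm2 (row i (ppds_X f eta X1 (V^~ w) (A^~ w) (B^~ w) t)
                       - xstar) ^+ 2].

Definition stepsize_ok {R : realType} (n m : nat) (L lambda eta : R) : Prop :=
  let nm : R := n%:R / m%:R in
  0 < eta <= Num.min ((1 - lambda) ^+ 2 / (14 * L) * Num.sqrt nm)
    (Num.min ((1 - lambda) ^+ 2 / (2304 * L) * nm `^ (3 / 2))
             (1 / (576 * L) * Num.sqrt nm)).

Definition rate {R : realType} (n m : nat) (mu eta : R) : R :=
  Num.max (1 - eta * mu * m%:R / (2 * n%:R)) (1 - m%:R / (4 * n%:R)).

(* Main.v *)
Require Import Defs.
From HB Require Import structures.
From mathcomp Require Import all_boot all_order all_algebra.
From mathcomp Require Import complex.
From mathcomp Require Import all_classical all_reals all_analysis.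
From mathcomp Require Import measurable_realfun ring lra.

Set Implicit Arguments.
Unset Strict Implicit.
Unset Printing Implicit Defensive.

Import Order.TTheory GRing.Theory Num.Theory.
Import numFieldNormedType.Exports.

Local Open Scope classical_set_scope.
Local Open Scope ring_scope.

(** Write [p = m / n], [k = 1 - lambda], [J = averaging_mx], and call direction
    the matrix [G = Y + grad F(X) - grad F(C)], of which the active nodes use
    their rows. Four errors are followed: the distance of the mean iterate to the
    minimizer, the disagreement of the iterates, the disagreement of the trackers
    [Y], and the staleness of the stored gradients, i.e. the distance of the
    gradients at [C] to those at the minimizer.

    Column sums are preserved by the mixing matrices, so the mean of [Y] always
    equals the mean of the stored gradients ([tracking_step]). The rows of [G]
    therefore sum to the sum of the current gradients, and since every node is
    active with probability [p], the mean iterate makes in expectation a step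
    [eta p] along the mean of the current gradients. Convexity and smoothness
    turn this into a descent, up to the disagreement of the iterates
    ([dot_gradient_ge]). The fluctuation of the step is at most
    [eta^2 p^2 |G|^2 / n], by the Cauchy-Schwarz inequality over the [m] active
    nodes ([dist_step_le]). The disagreements contract: mixing by [A] acts on them
    through the quadratic form of [A^T (I - J) A], whose mean is symmetric and
    hence at most its spectral radius ([qform_le_spectral_radius]). Since the
    active set and the matrices of one step may be dependent, the perturbation
    added by the active nodes is first separated from the mixed term by a
    weighted triangle inequality ([spread_mix_le]). Staleness decays at rate [p],
    because active nodes refresh their stored gradient ([grad_dev_step]). Finally
    [G], the correction sent and the current gradients are bounded by the four
    errors and the suboptimality ([sqfro_direction_le], [grad_dev_le]).

    For suitable weights the weighted sum of the four errors is then contracted by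
    [rate] in expectation, for a fixed state ([lyapunov_contraction],
    [mean_lyapunov_step]). To iterate this, the state at time [t] has to be frozen
    while the next triple is averaged. It is measurable for the sigma-algebra of
    the first [t] triples ([run_measurable]), which is independent of the next one
    by a pi-system argument, so Tonelli's theorem applies ([past_integral]). The
    measurability of the gradients comes from their Lipschitz continuity
    ([measurable_lipschitz]).

    The complexity follows by taking the largest admissible step size, which is at
    least [k^2 sqrt (n / m) / (2304 L)] ([stepsize_exists]). *)

(** * Euclidean geometry of the rows *)

Section EuclideanGeometry.
Context {R : realType} {d : nat}.
Implicit Types (x y z : 'rV[R]_d).

Definition dot x y : R := \sum_(j < d) x ord0 j * y ord0 j.
Definition sqn x : R := dot x x.

Lemma norm2_sqr x : norm2 x ^+ 2 = sqn x.
Proof.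
rewrite /norm2 sqr_sqrtr; last by apply: sumr_ge0 => j _; exact: sqr_ge0.
by apply: eq_bigr => j _; rewrite expr2.
Qed.

Lemma dotC x y : dot x y = dot y x.
Proof. by apply: eq_bigr => j _; rewrite mulrC. Qed.

Lemma dotDl x y z : dot (x + y) z = dot x z + dot y z.
Proof. by rewrite -big_split; apply: eq_bigr => j _; rewrite !mxE mulrDl. Qed.

Lemma dotDr x y z : dot z (x + y) = dot z x + dot z y.
Proof. by rewrite !(dotC z) dotDl. Qed.

Lemma dotZl a x y : dot (a *: x) y = a * dot x y.
Proof. by rewrite mulr_sumr; apply: eq_bigr => j _; rewrite !mxE mulrA. Qed.

Lemma dotZr a x y : dot x (a *: y) = a * dot x y.
Proof. by rewrite dotC dotZl dotC. Qed.

Lemma dotNl x y : dot (- x) y = - dot x y.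
Proof. by rewrite -scaleN1r dotZl mulN1r. Qed.

Lemma dotNr x y : dot x (- y) = - dot x y.
Proof. by rewrite dotC dotNl dotC. Qed.

Lemma dot0l y : dot 0 y = 0.
Proof. by rewrite -(scale0r 0) dotZl mul0r. Qed.

Lemma dot_suml (I : finType) (F : I -> 'rV[R]_d) y :
  dot (\sum_i F i) y = \sum_i dot (F i) y.
Proof.
elim/big_rec2: _ => [|i a b _ <-]; [exact: dot0l | exact: dotDl].
Qed.

Lemma dot_sumr (I : finType) (F : I -> 'rV[R]_d) y :
  dot y (\sum_i F i) = \sum_i dot y (F i).
Proof. by rewrite dotC dot_suml; apply: eq_bigr => i _; rewrite dotC. Qed.

Lemma sqn_ge0 x : 0 <= sqn x.
Proof. by apply: sumr_ge0 => j _; rewrite -expr2 sqr_ge0. Qed.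

Lemma sqnD x y : sqn (x + y) = sqn x + 2 * dot x y + sqn y.
Proof. by rewrite /sqn dotDl !dotDr (dotC y x); ring. Qed.

Lemma sqnB x y : sqn (x - y) = sqn x - 2 * dot x y + sqn y.
Proof. by rewrite sqnD /sqn dotNr dotNl dotNr; ring. Qed.

Lemma sqnZ a x : sqn (a *: x) = a ^+ 2 * sqn x.
Proof. by rewrite /sqn dotZl dotZr mulrA -expr2. Qed.

Lemma sqnN x : sqn (- x) = sqn x.
Proof. by rewrite /sqn dotNl dotNr opprK. Qed.

Lemma sqn0 : sqn 0 = 0.
Proof. exact: dot0l. Qed.

Lemma sqn_eq0 x : sqn x = 0 -> x = 0.
Proof.
move=> /eqP; rewrite psumr_eq0; last by move=> j _; rewrite -expr2 sqr_ge0.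
move=> /allP x0; apply/rowP => j; have := x0 j (mem_index_enum j).
by rewrite mulf_eq0 orbb mxE => /eqP.
Qed.

(** The convexity of the squared norm, with the two weights absorbed into the
    vectors: it splits a perturbed contraction into its two parts. *)
Lemma sqnD_le_weighted s x y : 0 < s < 1 ->
  sqn (x + y) <= s^-1 * sqn x + (1 - s)^-1 * sqn y.
Proof.
case/andP => s0 s1; have s1' : 0 < 1 - s by rewrite subr_gt0.
rewrite -subr_ge0.
have -> : s^-1 * sqn x + (1 - s)^-1 * sqn y - sqn (x + y) =
    s^-1 * (1 - s)^-1 * sqn ((1 - s) *: x - s *: y).
  rewrite sqnD sqnB !sqnZ dotZl dotZr; field.
  by rewrite !gt_eqF.
by rewrite mulr_ge0 ?sqn_ge0// mulr_ge0 ?invr_ge0 ?ltW.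
Qed.

Lemma sqnD_le2 x y : sqn (x + y) <= 2 * sqn x + 2 * sqn y.
Proof.
have /(sqnD_le_weighted x y) : 0 < (2^-1 : R) < 1 by apply/andP; split; lra.
by rewrite invrK (_ : 1 - 2^-1 = 2^-1 :> R) ?invrK//; lra.
Qed.

Lemma sqnB_le2 x y : sqn (x - y) <= 2 * sqn x + 2 * sqn y.
Proof. by rewrite -(sqnN y); exact: sqnD_le2. Qed.

(** Expand the weighted variance of the family, which is nonnegative. *)
Lemma sqn_jensen (I : finType) (w : I -> R) (F : I -> 'rV[R]_d) :
  (forall i, 0 <= w i) -> \sum_i w i = 1 ->
  sqn (\sum_i w i *: F i) <= \sum_i w i * sqn (F i).
Proof.
move=> w0 w1; set b := \sum_i w i *: F i.
have : 0 <= \sum_i w i * sqn (F i - b).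
  by apply: sumr_ge0 => i _; rewrite mulr_ge0 ?sqn_ge0.
have -> : \sum_i w i * sqn (F i - b) = \sum_i w i * sqn (F i)
    - 2 * \sum_i dot (w i *: F i) b + (\sum_i w i) * sqn b.
  rewrite mulr_sumr mulr_suml -sumrB -big_split; apply: eq_bigr => i _ /=.
  by rewrite sqnB dotZl; ring.
by rewrite -dot_suml -/b w1 -/(sqn b); lra.
Qed.

(** Cauchy-Schwarz over the active set, in the form whose expectation only needs
    the probability that a single node is active. *)
Lemma sqn_sum_le_card (I : finType) (V : {set I}) (F : I -> 'rV[R]_d) :
  sqn (\sum_i (i \in V)%:R *: F i) <=
  #|V|%:R * \sum_i (i \in V)%:R * sqn (F i).
Proof.
have [->|V0] := eqVneq V finset.set0.
  rewrite big1 ?sqn0 ?cards0 ?mul0r// => i _.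
  by rewrite finset.inE scale0r.
have m0 : (0 : R) < #|V|%:R by rewrite ltr0n card_gt0.
have w1 : \sum_i #|V|%:R^-1 * (i \in V)%:R = 1 :> R.
  rewrite -mulr_sumr -natr_sum.
  have -> : (\sum_i (i \in V) = #|V|)%N.
    by rewrite -sum1_card [RHS]big_mkcond; apply: eq_bigr => i _; case: (i \in V).
  by rewrite mulVf// gt_eqF.
have w0 i : 0 <= #|V|%:R^-1 * (i \in V)%:R :> R.
  by rewrite mulr_ge0 ?invr_ge0 ?ler0n.
have := sqn_jensen F w0 w1.
under eq_bigr do rewrite -scalerA; rewrite -scaler_sumr sqnZ.
under [in leRHS]eq_bigr do rewrite -mulrA; rewrite -mulr_sumr => h.
set a : R := #|V|%:R in m0 h *; set S := sqn _ in h *; set T := \sum_i _ in h *.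
have -> : S = a ^+ 2 * (a^-1 ^+ 2 * S) by field; rewrite gt_eqF.
have -> : a * T = a ^+ 2 * (a^-1 * T) by field; rewrite gt_eqF.
by rewrite ler_wpM2l ?sqr_ge0.
Qed.

End EuclideanGeometry.

(** * Averaging and mixing *)

Section Averaging.
Context {R : realType} {n d : nat}.
Hypothesis n0 : (0 < n)%N.
Implicit Types (X Y Z : 'M[R]_(n, d)) (A B : 'M[R]_n).

Let n0' : (0 : R) < n%:R. Proof. by rewrite ltr0n. Qed.

Definition rmean X : 'rV[R]_d := n%:R^-1 *: (const_mx 1 *m X).

Definition sqfro X : R := \sum_i sqn (row i X).

Definition centering : 'M[R]_n := 1%:M - averaging_mx.

Definition spread X : R := sqfro (centering *m X).

Lemma sqfro_ge0 X : 0 <= sqfro X.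
Proof. by apply: sumr_ge0 => i _; exact: sqn_ge0. Qed.

Lemma spread_ge0 X : 0 <= spread X.
Proof. exact: sqfro_ge0. Qed.

Lemma rmeanE X : rmean X = n%:R^-1 *: \sum_i row i X.
Proof.
congr (_ *: _); apply/rowP => j; rewrite mxE summxE; apply: eq_bigr => i _.
by rewrite !mxE mul1r.
Qed.

Lemma rmeanD X Y : rmean (X + Y) = rmean X + rmean Y.
Proof. by rewrite /rmean mulmxDr scalerDr. Qed.

Lemma rmeanN X : rmean (- X) = - rmean X.
Proof. by rewrite /rmean mulmxN scalerN. Qed.

Lemma averaging_mxE : averaging_mx = n%:R^-1 *:
  ((const_mx 1 : 'cV[R]_n) *m (const_mx 1 : 'rV[R]_n)).
Proof.
by apply/matrixP => i j; rewrite !mxE big_ord1 !mxE !mulr1.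
Qed.

Lemma row_averaging X i : row i (averaging_mx *m X) = rmean X.
Proof.
by rewrite averaging_mxE -scalemxAl -mulmxA; apply/rowP => j;
  rewrite !mxE big_ord1 !mxE mul1r.
Qed.

Lemma row_centering X i : row i (centering *m X) = row i X - rmean X.
Proof. by rewrite mulmxBl mul1mx linearB /= row_averaging. Qed.

Lemma spreadE X : spread X = \sum_i sqn (row i X - rmean X).
Proof. by apply: eq_bigr => i _; rewrite row_centering. Qed.

(** The bias-variance decomposition of the rows around any point. *)
Lemma spread_shift X z :
  \sum_i sqn (row i X - z) = spread X + n%:R * sqn (rmean X - z).
Proof.
rewrite spreadE; set b := rmean X.
have E i : sqn (row i X - z) =
    sqn (row i X - b) + 2 * dot (row i X - b) (b - z) + sqn (b - z).
  by rewrite -sqnD addrA subrK.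
under eq_bigr do rewrite E.
rewrite !big_split /= -mulr_sumr -dot_suml sumr_const card_ord.
have -> : \sum_i (row i X - b) = 0.
  by rewrite sumrB sumr_const card_ord /b rmeanE -scaler_nat scalerA
    divff ?gt_eqF// scale1r subrr.
by rewrite dot0l mulr0 addr0 mulr_natl.
Qed.

Lemma sqfroE X : sqfro X = spread X + n%:R * sqn (rmean X).
Proof.
by rewrite -[rmean X]subr0 -spread_shift; apply: eq_bigr => i _; rewrite subr0.
Qed.

Lemma spread_le_sqfro X : spread X <= sqfro X.
Proof. by rewrite sqfroE lerDl mulr_ge0 ?ler0n ?sqn_ge0. Qed.

Lemma sqn_rmean_le X : n%:R * sqn (rmean X) <= sqfro X.
Proof. by rewrite sqfroE lerDr spread_ge0. Qed.

Lemma sqfroZ a X : sqfro (a *: X) = a ^+ 2 * sqfro X.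
Proof.
rewrite mulr_sumr; apply: eq_bigr => i _.
by rewrite -sqnZ; congr sqn; apply/rowP => j; rewrite !mxE.
Qed.

Lemma sqfroD_le_weighted s X Y : 0 < s < 1 ->
  sqfro (X + Y) <= s^-1 * sqfro X + (1 - s)^-1 * sqfro Y.
Proof.
move=> s01; rewrite !mulr_sumr -big_split; apply: ler_sum => i _.
by rewrite linearD; exact: sqnD_le_weighted.
Qed.

Lemma spreadD_le2 X Y : spread (X + Y) <= 2 * spread X + 2 * spread Y.
Proof.
rewrite /spread mulmxDr !mulr_sumr -big_split; apply: ler_sum => i _.
by rewrite linearD; exact: sqnD_le2.
Qed.

Lemma averaging_mxM A : A *m (const_mx 1 : 'cV_n) = const_mx 1 ->
  A *m averaging_mx = averaging_mx.
Proof. by move=> A1; rewrite averaging_mxE -scalemxAr mulmxA A1. Qed.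

Lemma averaging_mx_idem : averaging_mx *m averaging_mx = averaging_mx :> 'M[R]_n.
Proof.
apply: averaging_mxM; apply/colP => i; rewrite !mxE.
under eq_bigr do rewrite !mxE mulr1.
by rewrite sumr_const card_ord -(mulr_natl n%:R^-1) divff// gt_eqF.
Qed.

Lemma centering_idem : centering *m centering = centering.
Proof.
by rewrite /centering mulmxBr mulmx1 mulmxBl mul1mx averaging_mx_idem subrr subr0.
Qed.

Lemma trmx_centering : centering^T = centering.
Proof.
by rewrite /centering linearB /= trmx1; congr (_ - _); apply/matrixP => i j;
  rewrite !mxE.
Qed.

Lemma centering_stochastic A : A *m (const_mx 1 : 'cV_n) = const_mx 1 ->
  centering *m A *m centering = centering *m A.
Proof.
move=> A1; have -> : centering *m A *m centering =
    centering *m A - centering *m (A *m averaging_mx).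
  by rewrite mulmxA [LHS]mulmxBr mulmx1.
have C0 : centering *m averaging_mx = 0.
  by rewrite [LHS]mulmxBl mul1mx averaging_mx_idem subrr.
by rewrite averaging_mxM// C0 subr0.
Qed.

Lemma rmean_stochastic A X : (const_mx 1 : 'rV_n) *m A = const_mx 1 ->
  rmean (A *m X) = rmean X.
Proof. by move=> A1; rewrite /rmean mulmxA A1. Qed.

Lemma row_mul_sum A X i : row i (A *m X) = \sum_j A i j *: row j X.
Proof.
apply/rowP => k; rewrite mxE mxE summxE; apply: eq_bigr => j _.
by rewrite !mxE.
Qed.

(** Jensen in each row, using the row sums, then the column sums. *)
Lemma sqfro_stochastic A X : doubly_stochastic A -> sqfro (A *m X) <= sqfro X.
Proof.
case=> A0 Ar Ac.
have row1 i : \sum_j A i j = 1.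
  have /colP/(_ i) := Ar; rewrite !mxE => <-.
  by apply: eq_bigr => j _; rewrite mxE mulr1.
have col1 j : \sum_i A i j = 1.
  have /rowP/(_ j) := Ac; rewrite !mxE => <-.
  by apply: eq_bigr => i _; rewrite mxE mul1r.
apply: (@le_trans _ _ (\sum_i \sum_j A i j * sqn (row j X))).
  by apply: ler_sum => i _; rewrite row_mul_sum sqn_jensen.
rewrite exchange_big; apply: ler_sum => j _.
by rewrite -mulr_suml col1 mul1r.
Qed.

Lemma doubly_stochastic_le1 A i j : doubly_stochastic A -> A i j <= 1.
Proof.
case=> A0 Ar _; have /colP/(_ i) := Ar; rewrite !mxE => <-.
rewrite (bigD1 j)//= mxE mulr1 lerDl; apply: sumr_ge0 => k _.
by rewrite mxE mulr1.
Qed.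

(** [qform M Z] is the trace of [Z^T M Z]. *)
Definition qform (M : 'M[R]_n) Z : R :=
  \sum_i \sum_j M i j * dot (row i Z) (row j Z).

(** [I - J] is an orthogonal projection, so the squared norm of [(I - J) A Z] is a
    quadratic form in the matrix whose mean defines the mixing parameter. *)
Lemma spread_mul A Z : spread (A *m Z) =
  qform (A^T *m centering *m A) Z.
Proof.
rewrite /spread mulmxA; set Q := centering *m A.
have -> : A^T *m centering *m A = Q^T *m Q.
  by rewrite /Q trmx_mul trmx_centering -mulmxA -{1}centering_idem !mulmxA.
rewrite /qform /sqfro.
under eq_bigr do rewrite row_mul_sum /sqn dot_suml.
rewrite exchange_big; apply: eq_bigr => i _ /=.
under eq_bigr do rewrite dot_sumr.
rewrite exchange_big; apply: eq_bigr => j _ /=.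
rewrite mxE mulr_suml; apply: eq_bigr => k _.
by rewrite dotZl dotZr !mxE mulrA.
Qed.

(** The perturbation [W] may depend on [A], so the two contributions are separated
    before any expectation: the first one is left as a quadratic form to be
    averaged, and in the second one a doubly stochastic matrix is a contraction. *)
Lemma spread_mix_le s A Z W : 0 < s < 1 -> doubly_stochastic A ->
  spread (A *m (Z + W)) <=
  s^-1 * qform (A^T *m centering *m A) (centering *m Z) +
  (1 - s)^-1 * sqfro W.
Proof.
move=> s01 dA; have [A0 Ar Ac] := dA.
rewrite /spread mulmxDr mulmxDr.
apply: le_trans (sqfroD_le_weighted _ _ s01) _.
rewrite -spread_mul /spread !mulmxA centering_stochastic// lerD2l.
have s1 : 0 <= (1 - s)^-1 by case/andP: s01 => *; rewrite invr_ge0 subr_ge0 ltW.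
rewrite ler_wpM2l// -mulmxA.
exact: le_trans (spread_le_sqfro _) (sqfro_stochastic _ dA).
Qed.

End Averaging.
(** * Smooth and convex functions *)

Section SmoothConvex.
Context {R : realType} {d : nat}.
Implicit Types (f : 'rV[R]_d -> R) (x y z v : 'rV[R]_d) (L : R).

Lemma derive_gradient f x v : differentiable f x ->
  'D_v f x = dot (gradient f x) v.
Proof.
move=> df; rewrite deriveE// [in LHS](row_sum_delta v) linear_sum.
by apply: eq_bigr => j _; rewrite linearZ /= !mxE deriveE// mulrC.
Qed.

Lemma is_derive_line f x v t : (forall y, differentiable f y) ->
  is_derive (t : R) (1 : R) (fun s : R => f (x + s *: v))
    (dot (gradient f (x + t *: v)) v).
Proof.
move=> df.
have E : (fun h : R => h^-1 *: (((fun s : R => f (x + s *: v)) \o shift t)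
      (h *: (1 : R)) - f (x + t *: v))) =
    (fun h : R => h^-1 *: ((f \o shift (x + t *: v)) (h *: v)
      - f (x + t *: v))).
  apply/funext => h /=; congr (_ *: (f _ - _)).
  by rewrite scalerDl [h *: 1]mulr1 addrCA.
have dv : derivable f (x + t *: v) v by exact: diff_derivable.
apply: DeriveDef; first by rewrite /derivable E.
by rewrite /derive E -derive_gradient.
Qed.

(** The mean value theorem for [phi] minus the quadratic. *)
Lemma le_quadratic_of_derive (phi dphi : R -> R) (K : R) :
  (forall t, is_derive (t : R) (1 : R) phi (dphi t)) ->
  (forall t, 0 < t < 1 -> dphi t <= K * t) -> phi 1 <= phi 0 + K / 2.
Proof.
move=> dphiE dphi_le.
pose g : R -> R := fun t => phi t - K / 2 * t ^+ 2.
have gE : g = phi - (K / 2) \*: (id ^+ 2 : R -> R) by apply/funext.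
have dg t : is_derive (t : R) (1 : R) g (dphi t - K * t).
  rewrite gE; apply: is_derive_eq.
  by rewrite expr1 /= [_ *: (1 : R)]mulr1 -[_ *: _]/(_ * _); field.
have [|c] := @MVT R g _ 0 1 ltr01 (fun t _ => dg t).
  apply: continuous_subspaceT => t.
  by apply: differentiable_continuous; apply/derivable1_diffP; case: (dg t).
rewrite in_itv /= => /dphi_le hc.
by rewrite /g expr1n expr0n /=; lra.
Qed.

Lemma smooth_sqn L f x y : 0 < L -> smooth L f ->
  sqn (gradient f x - gradient f y) <= L ^+ 2 * sqn (x - y).
Proof.
move=> L0 [_ /(_ x y) h]; rewrite -!norm2_sqr -exprMn.
by rewrite lerXn2r// nnegrE ?mulr_ge0 ?sqrtr_ge0// ltW.
Qed.

Lemma dot_gradientB_le L f x v t : 0 < L -> 0 < t -> smooth L f ->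
  `|dot (gradient f (x + t *: v) - gradient f x) v| <= L * sqn v * t.
Proof.
move=> L0 t0 sf; set a := _ - _.
have ha : sqn a <= (L * t) ^+ 2 * sqn v.
  rewrite exprMn -mulrA -sqnZ; have := smooth_sqn (x + t *: v) x L0 sf.
  by rewrite addrAC subrr add0r.
have Lt0 : 0 < L * t by rewrite mulr_gt0.
have := sqn_ge0 (a - (L * t) *: v); have := sqn_ge0 (a + (L * t) *: v).
rewrite sqnB sqnD sqnZ !dotZr => h1 h2.
rewrite (_ : L * sqn v * t = L * t * sqn v); last by ring.
move: Lt0 ha h1 h2; move: (L * t) => p p0 ha h1 h2.
by rewrite ler_norml; apply/andP; split; rewrite -(ler_pM2l p0); lra.
Qed.

(** A function with Lipschitz gradient stays within a quadratic of its tangent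
    plane; both sides follow by integrating along the segment. *)
Lemma tangent_bound L f x y : 0 < L -> smooth L f ->
  `|f y - f x - dot (gradient f x) (y - x)| <= L / 2 * sqn (y - x).
Proof.
move=> L0 sf; have [df _] := sf; set v := y - x; set c := dot (gradient f x) v.
pose phi (t : R) := f (x + t *: v).
have dphi t := is_derive_line x v t df.
have bnd t : 0 < t < 1 ->
    `|dot (gradient f (x + t *: v)) v - c| <= L * sqn v * t.
  case/andP=> t0 _; have := dot_gradientB_le x v L0 t0 sf.
  by rewrite dotDl dotNl.
have e1 : phi 1 = f y by rewrite /phi scale1r /v addrC subrK.
have e0 : phi 0 = f x by rewrite /phi scale0r addr0.
have lin t : is_derive (t : R) (1 : R) (fun s : R => c * s) c.
  by apply: is_derive_eq; rewrite [c *: (1 : R)]mulr1.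
rewrite ler_norml; apply/andP; split.
  suff : c * 1 - phi 1 <= c * 0 - phi 0 + L * sqn v / 2 by rewrite e0 e1; lra.
  apply: (@le_quadratic_of_derive ((fun s : R => c * s) - phi)
    (fun t => c - dot (gradient f (x + t *: v)) v)) => t t01.
  by apply: le_trans (bnd t t01); rewrite distrC ler_norm.
suff : phi 1 - c * 1 <= phi 0 - c * 0 + L * sqn v / 2 by rewrite e0 e1; lra.
apply: (@le_quadratic_of_derive (phi - (fun s : R => c * s))
  (fun t => dot (gradient f (x + t *: v)) v - c)) => t t01.
by apply: le_trans (bnd t t01); rewrite ler_norm.
Qed.

Lemma smooth_le L f x y : 0 < L -> smooth L f ->
  f y <= f x + dot (gradient f x) (y - x) + L / 2 * sqn (y - x).
Proof.
by move=> L0 sf; have := tangent_bound x y L0 sf; rewrite ler_norml => /andP[]; lra.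
Qed.

(** The passage to the limit [t -> 0] in the convexity inequalities. *)
Lemma le0_of_le_mul (a b : R) : (forall t, 0 < t <= 1 -> a <= b * t) -> a <= 0.
Proof.
move=> h; rewrite leNgt; apply/negP => a0.
have [b0|b0] := leP b 0; first by have := h 1; rewrite ltr01 lexx => /(_ isT); lra.
have ab0 : 0 < a + b by lra.
have := h (a / (a + b)); rewrite divr_gt0// ler_pdivrMr// mul1r lerDl ltW//.
move=> /(_ isT); rewrite mulrA ler_pdivlMr//; nra.
Qed.

(** Divide the convexity inequality on the segment by [t]; the tangent bound stands
    in for the limit of the difference quotient. *)
Lemma convex_gradient_le L f x y : 0 < L -> smooth L f -> convex f ->
  f x + dot (gradient f x) (y - x) <= f y.
Proof.
move=> L0 sf cf; rewrite -subr_le0.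
apply: (@le0_of_le_mul _ (L / 2 * sqn (y - x))) => t /andP[t0 t1].
have := cf (Itv01 (ltW t0) t1) y x; rewrite !inE => /(_ Logic.I Logic.I).
rewrite convRE /=.
have -> : (conv (Itv01 (ltW t0) t1) (y : convex_lmodType 'rV[R]_d) x) =
    x + t *: (y - x).
  rewrite /conv /= scalerBl scale1r scalerBr.
  by rewrite addrCA addrA addrC addrA.
have := tangent_bound x (x + t *: (y - x)) L0 sf.
rewrite [x + _ - x]addrC addKr sqnZ dotZr ler_norml => /andP[h _] h2.
by rewrite -(ler_pM2l t0); move: h h2; rewrite /unstable.onem; lra.
Qed.

(** Compare the tangent plane at [z] with the quadratic upper bound at [x], at
    the point reached from [x] by a gradient step of [f] tilted at [z]. *)
Lemma sqn_gradientB_le L f x z : 0 < L -> smooth L f -> convex f ->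
  sqn (gradient f x - gradient f z) <=
  2 * L * (f x - f z - dot (gradient f z) (x - z)).
Proof.
move=> L0 sf cf; set g := _ - _.
pose y := x - L^-1 *: g.
have h1 := convex_gradient_le z y L0 sf cf.
have h2 := smooth_le x y L0 sf.
have e1 : y - x = - L^-1 *: g by rewrite /y addrC addKr scaleNr.
have e2 : y - z = (x - z) - L^-1 *: g by rewrite /y addrAC.
rewrite e1 sqnZ dotZr in h2; rewrite e2 dotDr dotNr dotZr in h1.
have e3 : dot (gradient f x) g = sqn g + dot (gradient f z) g.
  by rewrite /sqn -dotDl /g subrK.
have -> : 2 * L * (f x - f z - dot (gradient f z) (x - z)) =
   2 * L * ((f x - f z - dot (gradient f z) (x - z)) - L^-1 / 2 * sqn g) + sqn g.
  by field; rewrite gt_eqF.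
rewrite lerDr mulr_ge0//; first by rewrite mulr_ge0// ltW.
move: h2; rewrite e3 sqrrN.
have -> : L / 2 * (L^-1 ^+ 2 * sqn g) = L^-1 / 2 * sqn g.
  by field; rewrite gt_eqF.
lra.
Qed.

End SmoothConvex.
(** * The average of the local functions *)

Section AverageObjective.
Context {R : realType} {n d : nat}.
Variables (f : 'I_n -> 'rV[R]_d -> R) (L mu : R) (xs : 'rV[R]_d).
Hypotheses (n0 : (0 < n)%N) (L0 : 0 < L) (mu0 : 0 < mu).
Hypotheses (cf : forall i, convex (f i)) (sf : forall i, smooth L (f i)).
Hypotheses (scf : strongly_convex mu (average f)).
Hypotheses (minf : minimizer (average f) xs).
Implicit Types (x z : 'rV[R]_d) (X C : 'M[R]_(n, d)).

Let n0' : (0 : R) < n%:R. Proof. by rewrite ltr0n. Qed.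

Definition gap x : R := average f x - average f xs.

Lemma gap_ge0 x : 0 <= gap x.
Proof. by rewrite subr_ge0; exact: minf. Qed.

Lemma average_sum x : n%:R * average f x = \sum_i f i x.
Proof. by rewrite mulrA divff ?gt_eqF// mul1r. Qed.

Lemma gap_sum x : n%:R * gap x = \sum_i (f i x - f i xs).
Proof. by rewrite mulrBr !average_sum sumrB. Qed.

Lemma gap_le z : n%:R * gap (xs + z) <=
  dot (\sum_i gradient (f i) xs) z + n%:R * (L / 2 * sqn z).
Proof.
rewrite gap_sum dot_suml.
have -> : n%:R * (L / 2 * sqn z) = \sum_(i < n) L / 2 * sqn z.
  by rewrite sumr_const card_ord mulr_natl.
rewrite -big_split.
apply: ler_sum => i _ /=; have := smooth_le xs (xs + z) L0 (sf i).
by rewrite [xs + z - xs]addrC addKr; lra.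
Qed.

(** A gradient step away from the minimizer would otherwise decrease the
    average. *)
Lemma sum_gradient_minimizer : \sum_i gradient (f i) xs = 0.
Proof.
set S := \sum_i _; apply: sqn_eq0; apply/eqP; rewrite eq_le sqn_ge0 andbT.
pose c : R := (n%:R * L)^-1.
have c0 : 0 < c by rewrite invr_gt0 mulr_gt0.
have := gap_le (- c *: S); rewrite dotZr sqnZ -/S -/(sqn S) sqrrN.
have -> : n%:R * (L / 2 * (c ^+ 2 * sqn S)) = c / 2 * sqn S.
  by rewrite /c; field; rewrite !gt_eqF.
have := mulr_ge0 (ltW n0') (gap_ge0 (xs + - c *: S)) => h1 h2.
by rewrite -(pmulr_rle0 _ c0); lra.
Qed.

Lemma gap_quadratic_le z : gap (xs + z) <= L / 2 * sqn z.
Proof.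
have := gap_le z; rewrite sum_gradient_minimizer dot0l add0r.
by rewrite ler_pM2l.
Qed.

(** Compare the value at the minimizer with that at a nearby point of the segment
    to [x]. *)
Lemma gap_quadratic_ge x : mu / 2 * sqn (x - xs) <= gap x.
Proof.
rewrite -subr_le0.
apply: (@le0_of_le_mul _ _ (mu / 2 * sqn (x - xs))) => t /andP[t0 t1].
have := scf (Itv01 (ltW t0) t1) x xs; rewrite convRE /= norm2_sqr.
rewrite /unstable.onem; set z := conv _ _ _ => h.
have := gap_ge0 z; rewrite /gap => h2.
by rewrite -(ler_pM2l t0); lra.
Qed.

(** Test both quadratic bounds at distance one from the minimizer. This makes the
    descent rate slower than mixing. *)
Lemma strong_convexity_le_smoothness : (0 < d)%N -> mu <= L.
Proof.
move=> d0; pose e : 'rV[R]_d := delta_mx ord0 (Ordinal d0).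
have e1 : sqn e = 1.
  rewrite /sqn /dot (bigD1 (Ordinal d0))//= !mxE !eqxx mulr1 big1 ?addr0//.
  by move=> j j0; rewrite !mxE eqxx (negbTE j0) mulr0.
have := gap_quadratic_le e; have := gap_quadratic_ge (xs + e).
by rewrite [xs + e]addrC addrK e1; lra.
Qed.

(** At the stored points this is the staleness of the gradients; it controls the
    noise because it vanishes at the minimizer, unlike the gradients themselves. *)
Definition grad_dev X : R :=
  \sum_i sqn (gradient (f i) (row i X) - gradient (f i) xs).

Lemma grad_dev_ge0 X : 0 <= grad_dev X.
Proof. by apply: sumr_ge0 => i _; exact: sqn_ge0. Qed.

Lemma row_gradientF X i : row i (gradientF f X) = gradient (f i) (row i X).
Proof. by rewrite rowK. Qed.

Lemma sum_sqn_gradient_le x :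
  \sum_i sqn (gradient (f i) x - gradient (f i) xs) <=
  2 * L * (n%:R * gap x).
Proof.
have e : \sum_i dot (gradient (f i) xs) (x - xs) = 0.
  by rewrite -dot_suml sum_gradient_minimizer dot0l.
rewrite -[n%:R * _]subr0 -[X in _ - X]e gap_sum -sumrB mulr_sumr.
apply: ler_sum => i _; exact: sqn_gradientB_le.
Qed.

(** Go through the mean row: the Lipschitz bound pays for the disagreement and
    co-coercivity at the minimizer for the rest. *)
Lemma grad_dev_le X : grad_dev X <=
  2 * L ^+ 2 * spread X + 4 * L * (n%:R * gap (rmean X)).
Proof.
set b := rmean X.
apply: (@le_trans _ _ (2 * \sum_i sqn (gradient (f i) (row i X) - gradient (f i) b)
   + 2 * \sum_i sqn (gradient (f i) b - gradient (f i) xs))).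
  rewrite !mulr_sumr -big_split; apply: ler_sum => i _ /=.
  by rewrite -(subrKA (gradient (f i) b)) sqnD_le2.
have := sum_sqn_gradient_le b.
have : \sum_i sqn (gradient (f i) (row i X) - gradient (f i) b) <=
    L ^+ 2 * spread X.
  by rewrite spreadE mulr_sumr; apply: ler_sum => i _; exact: smooth_sqn.
lra.
Qed.

(** Each local gradient supports its function at its own row, while smoothness
    moves the function value from that row to the mean of the rows. *)
Lemma dot_gradient_ge X : n%:R * gap (rmean X) - L / 2 * spread X <=
  \sum_i dot (gradient (f i) (row i X)) (rmean X - xs).
Proof.
set b := rmean X; rewrite gap_sum spreadE mulr_sumr -sumrB.
apply: ler_sum => i _; set x := row i X.
have := smooth_le x b L0 (sf i); have := convex_gradient_le x xs L0 (sf i) (cf i).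
by rewrite -(sqnN (b - x)) opprB !dotDr !dotNr; lra.
Qed.

Definition gradF_diff X C := gradientF f X - gradientF f C.

Lemma sqfro_gradF_diff_le X C :
  sqfro (gradF_diff X C) <= 2 * grad_dev X + 2 * grad_dev C.
Proof.
rewrite !mulr_sumr -big_split; apply: ler_sum => i _ /=.
rewrite linearB /= !row_gradientF.
by rewrite -(subrKA (gradient (f i) xs)) -[X in _ + X]opprB sqnB_le2.
Qed.

Lemma sqn_rmean_gradF_le X : n%:R * sqn (rmean (gradientF f X)) <= grad_dev X.
Proof.
pose Gs : 'M[R]_(n, d) := \matrix_i gradient (f i) xs.
have Gs0 : rmean Gs = 0.
  rewrite rmeanE; under eq_bigr do rewrite rowK.
  by rewrite sum_gradient_minimizer scaler0.
have -> : rmean (gradientF f X) = rmean (gradientF f X - Gs).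
  by rewrite rmeanD rmeanN Gs0 subr0.
apply: le_trans (sqn_rmean_le n0 _) _; apply: ler_sum => i _.
by rewrite linearB /= row_gradientF rowK.
Qed.

(** The direction followed by the active nodes: its mean is that of the current
    gradients, whatever the stale ones are, and only its deviations depend on
    the tracking error and on the staleness. *)
Lemma sqfro_direction_le X Y C : rmean Y = rmean (gradientF f C) ->
  sqfro (Y + gradF_diff X C) <=
  2 * spread Y + 5 * grad_dev X + 4 * grad_dev C.
Proof.
move=> inv; rewrite sqfroE//.
have -> : rmean (Y + gradF_diff X C) = rmean (gradientF f X).
  by rewrite !rmeanD rmeanN inv addrC subrK.
have := spreadD_le2 Y (gradF_diff X C).
have := spread_le_sqfro n0 (gradF_diff X C).
have := sqfro_gradF_diff_le X C; have := sqn_rmean_gradF_le X; lra.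
Qed.

End AverageObjective.
(** * Quadratic forms and the spectral radius *)

Section SpectralBound.
Context {R : realType}.
Local Notation C := (R[i]).
Local Notation toC := (real_complex R).

Lemma normc_toC (z : C) : toC (Normc.normc z) = `|z|.
Proof. by case: z => a b; rewrite normc_def. Qed.

(** The supremum is finite because the eigenvalues are the roots of the
    characteristic polynomial. *)
Lemma eigenvalue_le_spectral_radius n (M : 'M[R]_n) (z : C) :
  eigenvalue (map_mx toC M) z -> Normc.normc z <= spectral_radius M.
Proof.
move=> ez; apply: ub_le_sup; last by exists z.
set A := map_mx toC M.
have [s ps] := closed_field_poly_normal (char_poly A).
exists (\sum_(y <- s) Normc.normc y) => _ [y [ey ->]].
have ys : y \in s.
  have : root (char_poly A) y by rewrite -eigenvalue_root_char.
  rewrite ps rootZ ?root_prod_XsubC//.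
  by rewrite lead_coef_eq0 monic_neq0 ?char_poly_monic.
rewrite (perm_big _ (perm_to_rem ys)) big_cons lerDl.
by apply: sumr_ge0 => -[a b] _; exact: sqrtr_ge0.
Qed.

Lemma spectral_radius_ge0 n (M : 'M[R]_n) : (0 < n)%N -> 0 <= spectral_radius M.
Proof.
move=> n0; have [z ez] := eigenvalue_closed (map_mx toC M) n0.
apply: le_trans (eigenvalue_le_spectral_radius ez).
by case: z {ez} => a b; exact: sqrtr_ge0.
Qed.

Local Open Scope sesquilinear_scope.

(** Diagonalize in an orthonormal basis: the diagonal entries are real, and they
    are eigenvalues. *)
Lemma quadratic_form_le_spectral_radius n (M : 'M[R]_n) (x : 'rV[R]_n) :
  M^T = M -> (x *m M *m x^T) 0 0 <= spectral_radius M * (x *m x^T) 0 0.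
Proof.
move=> MT; set A := map_mx toC M; set r := spectral_radius M.
have conj_toC p q (N : 'M[R]_(p, q)) : (map_mx toC N)^t* = map_mx toC N^T.
  apply/matrixP => i j; rewrite !mxE.
  by rewrite conj_Creal// complex_real.
have hA : A \is hermsymmx.
  apply/is_hermitianmxP; rewrite expr0 scale1r.
  by rewrite conj_toC MT.
have realD := hermitian_spectral_diag_real hA.
have /orthomx_spectralP := hermitian_normalmx hA.
set P := spectralmx A; set D := spectral_diag A => AE.
have PU : P \is unitarymx by exact: spectral_unitarymx.
have Punit : P \in unitmx by exact: spectral_unit.
have PA : P *m A = diag_mx D *m P.
  by rewrite {1}AE !mulmxA mulmxV// mul1mx.
have Dle k : D 0 k <= toC r.
  have Dk : eigenvalue A (D 0 k).
    apply/eigenvalueP; exists (row k P).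
      by rewrite -row_mul PA row_mul row_diag_mx -scalemxAl -rowE.
    apply/eqP => Pk0; have /row_unitarymxP/(_ k k) := PU.
    by rewrite dotmxE Pk0 mul0mx mxE eqxx => /esym/eqP; rewrite oner_eq0.
  apply: (@le_trans _ _ `|D 0 k|).
    by apply: real_ler_norm; have /mxOverP/(_ 0 k) := realD.
  by rewrite -normc_toC lecR eigenvalue_le_spectral_radius.
set v := map_mx toC x; set w := v *m P^t*.
have vE : v = w *m P by rewrite /w mulmxKtV.
have formE N : (v *m map_mx toC N *m v^t*) 0 0 = toC ((x *m N *m x^T) 0 0).
  by rewrite conj_toC -!map_mxM mxE.
rewrite -lecR rmorphM /= -formE -/A.
have -> : toC ((x *m x^T) 0 0) = (v *m v^t*) 0 0.
  by rewrite conj_toC -!map_mxM [RHS]mxE.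
have wE : v^t* = P^t* *m w^t* by rewrite {1}vE trmx_mul map_mxM.
have PP : P *m P^t* = 1%:M by apply/unitarymxP.
rewrite wE {1 2}vE !mulmxA -(mulmxA w) PA !mulmxA.
rewrite -[w *m diag_mx D *m P *m _]mulmxA -[w *m P *m _]mulmxA PP !mulmx1.
rewrite mul_mx_diag !mxE mulr_sumr; apply: ler_sum => k _.
rewrite !mxE mulrAC [leRHS]mulrC ler_wpM2l//.
by rewrite mul_conjC_ge0.
Qed.

Lemma qform_le_spectral_radius n d (M : 'M[R]_n) (Z : 'M[R]_(n, d)) :
  M^T = M -> qform M Z <= spectral_radius M * sqfro Z.
Proof.
move=> MT; have -> : qform M Z = \sum_k (row k Z^T *m M *m (row k Z^T)^T) 0 0.
  rewrite /qform; under eq_bigr do under eq_bigr do rewrite mulr_sumr.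
  under eq_bigr do rewrite exchange_big.
  rewrite exchange_big; apply: eq_bigr => k _ /=.
  rewrite exchange_big [RHS]mxE; apply: eq_bigr => j _ /=.
  rewrite [X in _ = X * _]mxE mulr_suml; apply: eq_bigr => i _; rewrite !mxE; ring.
have -> : sqfro Z = \sum_k (row k Z^T *m (row k Z^T)^T) 0 0.
  rewrite /sqfro exchange_big; apply: eq_bigr => k _ /=.
  by rewrite mxE; apply: eq_bigr => i _; rewrite !mxE.
rewrite mulr_sumr; apply: ler_sum => k _.
exact: quadratic_form_le_spectral_radius.
Qed.


End SpectralBound.
(** * The Lyapunov inequality *)

Section LyapunovCoefficients.
Context {R : realType}.
Variables (eta L mu p k rho : R).

(** The weights of the disagreements and of the staleness. Each makes the decay of
    its own error balance exactly what this error feeds into the errors weighted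
    before it: [U] against the loss of descent, including what it causes through
    the current gradients, then [V], then [W]. *)
Definition coef_U : R := 6 * eta * L * p / k.
Definition coef_V : R :=
  eta ^+ 2 * p ^+ 2 * (8 / k) * (1 + 12 * eta * L / k ^+ 2).
Definition coef_W : R :=
  16 / 3 * eta ^+ 2 * p * (1 + 12 * eta * L / k ^+ 2) * (1 + 8 * p / k ^+ 2).

Hypotheses (eta0 : 0 < eta) (L0 : 0 < L) (mu0 : 0 < mu) (muL : mu <= L).
Hypotheses (p01 : 0 < p <= 1) (k01 : 0 < k <= 1).
(** With [x = eta L sqrt p], the three bounds on the step size say that [x] is at
    most [k^2 / 14], [k^2 / (2304 p)] and [1 / 576]. *)
Hypotheses (step1 : eta * L * Num.sqrt p <= k ^+ 2 / 14)
  (step2 : eta * L * Num.sqrt p * p <= k ^+ 2 / 2304)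
  (step3 : eta * L * Num.sqrt p <= 1 / 576).
Hypotheses (rho_a : 1 - eta * mu * p / 2 <= rho) (rho_c : 1 - p / 4 <= rho).

Let p0 : 0 < p. Proof. by case/andP: p01. Qed.
Let k0 : 0 < k. Proof. by case/andP: k01. Qed.
Let h0 : 0 < eta * L. Proof. exact: mulr_gt0. Qed.

Lemma coef_U_gt0 : 0 < coef_U.
Proof. by rewrite /coef_U !mulr_gt0 ?invr_gt0// ltr0n. Qed.

Lemma coef_V_ge0 : 0 <= coef_V.
Proof.
have [e0 l0 q0 k0'] : [/\ 0 <= eta, 0 <= L, 0 <= p & 0 <= k] by rewrite !ltW.
by rewrite /coef_V; do ![by []|apply: exprn_ge0|apply: mulr_ge0|apply: addr_ge0
  |rewrite invr_ge0].
Qed.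

Lemma coef_W_ge0 : 0 <= coef_W.
Proof.
have [e0 l0 q0 k0'] : [/\ 0 <= eta, 0 <= L, 0 <= p & 0 <= k] by rewrite !ltW.
by rewrite /coef_W; do ![by []|apply: exprn_ge0|apply: mulr_ge0|apply: addr_ge0
  |rewrite invr_ge0].
Qed.

(** The total weight with which the current gradients enter one step. *)
Definition coef_N : R := 5 * (eta ^+ 2 * p ^+ 2) +
  5 * (coef_U * (2 / k) * eta ^+ 2 * p) + 2 * (coef_V * (2 / k) * p) + coef_W * p.

Let sqrtp0 : 0 < Num.sqrt p. Proof. by rewrite sqrtr_gt0. Qed.
Let sqrtp1 : Num.sqrt p <= 1.
Proof. by rewrite -[leRHS]sqrtr1 ler_wsqrtr//; case/andP: p01. Qed.
Let x0 : 0 < eta * L * Num.sqrt p. Proof. exact: mulr_gt0. Qed.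

(** With [x = eta L sqrt p] and [y = 1 / k^2], every monomial of the left-hand side
    divided by [eta p] is a product of the quantities [x], [x y] and [x p y] that
    the step-size conditions bound, up to powers of [sqrt p <= 1]. *)
Lemma coef_N_le : 4 * L * coef_N <= eta * p.
Proof.
have pE : p = Num.sqrt p ^+ 2 by rewrite sqr_sqrtr// ltW.
move: step1 step2 step3 x0 h0; set h := eta * L.
set x := h * Num.sqrt p => s1 s2 s3 x1 h1.
pose y := (k ^+ 2)^-1.
have y0 : 0 < y by rewrite invr_gt0 exprn_gt0.
have kn : k != 0 by rewrite gt_eqF.
have b1 : x * y <= 1 / 14.
  by rewrite ler_pdivrMr ?exprn_gt0//; move: s1; lra.
have b2 : x * p * y <= 1 / 2304.
  by rewrite ler_pdivrMr ?exprn_gt0//; move: s2; lra.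
have c1 : h * p <= 1 / 576.
  by apply: le_trans s3; rewrite {1}pE expr2 mulrA ger_pMr.
have c2 : h ^+ 2 * p * y <= 1 / 576 * (1 / 14).
  have -> : h ^+ 2 * p * y = x * (x * y) by rewrite {1}pE /x; ring.
  by rewrite ler_pM// ?mulr_ge0 ?ltW.
have c3 : h * p ^+ 2 * y <= 1 / 2304.
  apply: le_trans b2; rewrite ler_wpM2r ?(ltW y0)//.
  by rewrite expr2 mulrA ler_wpM2r ?(ltW p0)// {1}pE expr2 mulrA ger_pMr.
have c4 : h ^+ 2 * p ^+ 2 * y ^+ 2 <= 1 / 14 * (1 / 2304).
  have -> : h ^+ 2 * p ^+ 2 * y ^+ 2 = (x * y) * (x * p * y).
    have xx : x * x = h ^+ 2 * p by rewrite {1}pE /x; ring.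
    by transitivity (x * x * (p * y * y)); [rewrite xx|]; ring.
  by rewrite ler_pM// ?mulr_ge0 ?ltW.
have -> : 4 * L * coef_N = eta * p * (4 * (31 / 3 * (h * p)
    + 31 / 3 * 12 * (h ^+ 2 * p * y) + 224 / 3 * (h * p ^+ 2 * y)
    + 224 / 3 * 12 * (h ^+ 2 * p ^+ 2 * y ^+ 2))).
  by rewrite /coef_N /coef_U /coef_V /coef_W /y /h; field.
rewrite -[leRHS]mulr1 ler_pM2l ?mulr_gt0//; lra.
Qed.

Lemma coef_N_ge0 : 0 <= coef_N.
Proof.
have U0 := ltW coef_U_gt0; have V0 := coef_V_ge0; have W0 := coef_W_ge0.
have e0 := ltW eta0; have q0 := ltW p0; have l0 := ltW k0.
by rewrite /coef_N; do ![by []|apply: exprn_ge0|apply: mulr_ge0|apply: addr_ge0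
  |rewrite invr_ge0].
Qed.

(** Mixing contracts at rate [k / 2]; the first step-size condition leaves half of
    it after the overall rate has been subtracted. *)
Lemma rate_ge_mixing : 1 - k / 4 <= rho.
Proof.
apply: le_trans rho_a; rewrite lerD2l lerN2.
have h1 : eta * mu * p <= k ^+ 2 / 14.
  apply: le_trans step1; rewrite -!mulrA ler_pM2l//.
  have pr : p <= Num.sqrt p by rewrite -{1}(sqr_sqrtr (ltW p0)) expr2 ger_pMr.
  by apply: ler_pM => //; exact: ltW.
have : k ^+ 2 <= k by rewrite expr2 ger_pMr//; case/andP: k01.
by have := k0; lra.
Qed.

(** One step on the four error terms: [a] is the distance of the mean iterate to
    the minimizer, [u] and [v] the disagreements on iterates and on gradient
    trackers, [c] the staleness of the stored gradients; [g] measures the current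
    gradients, [F] the suboptimality, [gam] the direction and [del] the
    correction sent.  The direction is paid for by the half of the descent [F]
    that strong convexity does not use. *)
Lemma lyapunov_contraction (a u v c g F q gam del a' u' v' c' : R) :
  0 <= a -> 0 <= u -> 0 <= v -> 0 <= c -> 0 <= F ->
  gam <= 2 * v + 5 * g + 4 * c -> del <= 2 * g + 2 * c ->
  g <= 2 * L ^+ 2 * u + 4 * L * F -> mu / 2 * a <= F -> F - L / 2 * u <= q ->
  a' <= a - 2 * eta * p * q + eta ^+ 2 * p ^+ 2 * gam ->
  u' <= (1 - k / 2) * u + 2 / k * eta ^+ 2 * p * gam ->
  v' <= (1 - k / 2) * v + 2 / k * p * del ->
  c' <= (1 - p) * c + p * g ->
  a' + coef_U * u' + coef_V * v' + coef_W * c' <=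
  rho * (a + coef_U * u + coef_V * v + coef_W * c).
Proof.
move=> a0 u0 v0 c0 F0 hgam hdel hg hF hq ha hu hv hc.
have U0 := ltW coef_U_gt0; have V0 := coef_V_ge0; have W0 := coef_W_ge0.
have N0 := coef_N_ge0; have N4 := coef_N_le.
have kn : k != 0 by rewrite gt_eqF.
have [e0 l0 q0 k0'] : [/\ 0 <= eta, 0 <= L, 0 <= p & 0 <= k] by rewrite !ltW.
set U := coef_U in U0 *; set V := coef_V in V0 *; set W := coef_W in W0 *.
set N := coef_N in N0 N4.
have {}hu := ler_wpM2l U0 hu; have {}hv := ler_wpM2l V0 hv.
have {}hc := ler_wpM2l W0 hc.
have {}hq : 2 * eta * p * (F - L / 2 * u) <= 2 * eta * p * q.
  by rewrite ler_wpM2l// !mulr_ge0 ?ltW.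
set Gm := eta ^+ 2 * p ^+ 2 + U * (2 / k * eta ^+ 2 * p).
set Dl := V * (2 / k * p).
have Gm0 : 0 <= Gm.
  by do ![by []|apply: exprn_ge0|apply: mulr_ge0|apply: addr_ge0|rewrite invr_ge0].
have Dl0 : 0 <= Dl.
  by do ![by []|apply: mulr_ge0|rewrite invr_ge0].
have {}hgam := ler_wpM2l Gm0 hgam; have {}hdel := ler_wpM2l Dl0 hdel.
have {}hg := ler_wpM2l N0 hg.
(* the coefficients with which [g], [v] and [c] enter; the weights were chosen to
   make the last three of these four identities hold *)
have eN : N = 5 * Gm + 2 * Dl + W * p.
  by rewrite /N /coef_N -/U -/V -/W /Gm /Dl; ring.
have eV : 2 * Gm = V * (k / 4).
  by rewrite /Gm /V /coef_V /U /coef_U; field.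
have eW : 4 * Gm + 2 * Dl = W * (3 / 4 * p).
  by rewrite /Gm /Dl /W /coef_W /V /coef_V /U /coef_U; field.
have eU : 3 / 2 * (eta * p * L) = U * (k / 4) by rewrite /U /coef_U; field.
have NF : 4 * L * N * F <= eta * p * F by rewrite ler_wpM2r.
have Nu : 4 * L * N * (L * u) <= eta * p * (L * u).
  by rewrite ler_wpM2r// mulr_ge0// ltW.
have ra := ler_wpM2r a0 rho_a.
have ru := ler_wpM2r (mulr_ge0 U0 u0) rate_ge_mixing.
have rv := ler_wpM2r (mulr_ge0 V0 v0) rate_ge_mixing.
have rc := ler_wpM2r (mulr_ge0 W0 c0) rho_c.
have hFa : eta * p * (mu / 2 * a) <= eta * p * F.
  by rewrite ler_wpM2l// mulr_ge0 ?ltW.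
have eVv : 2 * Gm * v = V * (k / 4) * v by rewrite eV.
have eWc : (4 * Gm + 2 * Dl) * c = W * (3 / 4 * p) * c by rewrite eW.
have eUu : 3 / 2 * (eta * p * L) * u = U * (k / 4) * u by rewrite eU.
have eNg : N * g = (5 * Gm + 2 * Dl + W * p) * g by rewrite eN.
have s1 : a' + U * u' + V * v' + W * c' <=
    a - 2 * eta * p * (F - L / 2 * u) + (1 - k / 2) * (U * u)
    + (1 - k / 2) * (V * v) + (1 - p) * (W * c) + Gm * gam + Dl * del + W * p * g.
  by rewrite /Gm /Dl; lra.
apply: le_trans s1 _.
have s2 : Gm * gam + Dl * del + W * p * g <= N * g + V * (k / 4) * v
    + W * (3 / 4 * p) * c.
  by lra.
have s3 : N * g <= 1 / 2 * (eta * p * (L * u)) + eta * p * F.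
  by lra.
rewrite !mulrDr; lra.
Qed.

End LyapunovCoefficients.
(** * Measurability *)

Section EntrywiseMeasurability.
Context {R : realType} {dT : measure_display} {T : measurableType dT}.

Definition mx_measurable {p q} (M : T -> 'M[R]_(p, q)) : Prop :=
  forall i j, measurable_fun [set: T] (fun w => M w i j).

Lemma mx_measurable_cst p q (M : 'M[R]_(p, q)) : mx_measurable (fun=> M).
Proof. by move=> i j; exact: measurable_cst. Qed.

Lemma mx_measurableD p q (M N : T -> 'M[R]_(p, q)) : mx_measurable M ->
  mx_measurable N -> mx_measurable (fun w => M w + N w).
Proof.
move=> mM mN i j; rewrite (_ : (fun _ => _) = (fun w => M w i j) \+ (fun w => N w i j)).
  exact: measurable_funD.
by apply/funext => w; rewrite mxE.
Qed.

Lemma mx_measurableZ p q a (M : T -> 'M[R]_(p, q)) : mx_measurable M ->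
  mx_measurable (fun w => a *: M w).
Proof.
move=> mM i j; rewrite (_ : (fun _ => _) = (fun w => a) \* (fun w => M w i j)).
  by apply: measurable_funM => //; exact: measurable_cst.
by apply/funext => w; rewrite mxE.
Qed.

Lemma mx_measurableB p q (M N : T -> 'M[R]_(p, q)) : mx_measurable M ->
  mx_measurable N -> mx_measurable (fun w => M w - N w).
Proof.
move=> mM mN; apply: mx_measurableD => // i j.
have := mx_measurableZ (-1) mN i j.
by under eq_fun do rewrite scaleN1r.
Qed.

Lemma mx_measurableM p q r (M : T -> 'M[R]_(p, q)) (N : T -> 'M[R]_(q, r)) :
  mx_measurable M -> mx_measurable N -> mx_measurable (fun w => M w *m N w).
Proof.
move=> mM mN i j; under eq_fun do rewrite mxE.
by apply: measurable_sum => k; exact: measurable_funM.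
Qed.

Lemma mx_measurable_row p q (M : T -> 'M[R]_(p, q)) i :
  mx_measurable M -> mx_measurable (fun w => row i (M w)).
Proof. by move=> mM a j; under eq_fun do rewrite mxE; exact: mM. Qed.

Lemma mx_measurable_tr p q (M : T -> 'M[R]_(p, q)) :
  mx_measurable M -> mx_measurable (fun w => (M w)^T).
Proof. by move=> mM a j; under eq_fun do rewrite mxE; exact: mM. Qed.

Lemma measurable_sqn d (x : T -> 'rV[R]_d) :
  mx_measurable x -> measurable_fun [set: T] (fun w => sqn (x w)).
Proof. by move=> mx; apply: measurable_sum => k; exact: measurable_funM. Qed.

Lemma measurable_sqfro p q (M : T -> 'M[R]_(p, q)) :
  mx_measurable M -> measurable_fun [set: T] (fun w => sqfro (M w)).
Proof.
by move=> mM; apply: measurable_sum => i; apply/measurable_sqn/mx_measurable_row.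
Qed.

Lemma mx_measurable_active n (V : T -> {set 'I_n}) :
  measurable_fun setT V -> mx_measurable (fun w => active_mx (R := R) (V w)).
Proof.
move=> mV i j.
exact: (@measurableT_comp _ _ _ _ _ _ (fun S : {set 'I_n} => active_mx S i j)).
Qed.

(** A function that is Lipschitz for the l1 norm lies below [a] exactly where one
    of the cones over rational points does, and there are countably many of
    these. *)
Lemma measurable_lipschitz d (g : 'rV[R]_d -> R) (K : R) (x : T -> 'rV[R]_d) :
  0 < K -> (forall y z, g y <= g z + K * \sum_j `|y ord0 j - z ord0 j|) ->
  mx_measurable x -> measurable_fun [set: T] (fun w => g (x w)).
Proof.
move=> K0 Kg mx mT; apply: (measurability _ (RGenInftyO.measurableE R)) => //.
move=> /= _ [_ [a ->] <-]; rewrite setTI preimage_itvNyo.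
pose q (r : 'rV[rat]_d) : 'rV[R]_d := map_mx ratr r.
pose cone r w := g (q r) + K * \sum_j `|x w ord0 j - q r ord0 j|.
rewrite [X in measurable X](_ : _ = \bigcup_r [set w | cone r w < a]); last first.
  apply/seteqP; split=> [w /= gw|w [r _] /=]; last exact: le_lt_trans (Kg _ _).
  pose e := (a - g (x w)) / (2 * K * d.+1%:R).
  have e0 : 0 < e by rewrite divr_gt0 ?subr_gt0// !mulr_gt0// ltr0n.
  have /choice[r hr] (j : 'I_d) : exists r : rat, x w ord0 j < ratr r < x w ord0 j + e.
    have [|r] := @rat_in_itvoo R (x w ord0 j) (x w ord0 j + e).
      by rewrite ltrDl.
    by rewrite in_itv /= => hr; exists r.
  exists (\row_j r j) => //=; rewrite /cone.
  set S := \sum_j _.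
  have SE : S <= d%:R * e.
    apply: (@le_trans _ _ (\sum_(j < d) e)); last first.
      by rewrite sumr_const card_ord mulr_natl.
    apply: ler_sum => j _; rewrite !mxE distrC ler_norml.
    by have := hr j; lra.
  have S2 : \sum_j `|q (\row_j r j) ord0 j - x w ord0 j| = S.
    by apply: eq_bigr => j _; rewrite distrC.
  have := Kg (q (\row_j r j)) (x w); rewrite S2 => h.
  have hS : 2 * K * S < a - g (x w).
    apply: (@le_lt_trans _ _ (2 * K * (d%:R * e))).
      by rewrite ler_pM2l// mulr_gt0.
    have -> : 2 * K * (d%:R * e) = (a - g (x w)) * (d%:R / d.+1%:R).
      by rewrite /e; field; rewrite gt_eqF//= gt_eqF// ltr0n.
    by rewrite gtr_pMr ?subr_gt0// ltr_pdivrMr ?ltr0n// mul1r ltr_nat.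
  by lra.
apply: countable_bigcupT_measurable => // r.
rewrite -preimage_itvNyo -[X in measurable X]setTI.
apply: (_ : measurable_fun [set: T] (cone r)) => //.
apply: measurable_funD; first exact: measurable_cst.
apply: measurable_funM; first exact: measurable_cst.
apply: measurable_sum => j; apply: measurableT_comp => //.
by apply: measurable_funB; [exact: mx|exact: measurable_cst].
Qed.

Lemma sqn_le_sqr_sum d (x : 'rV[R]_d) : sqn x <= (\sum_j `|x ord0 j|) ^+ 2.
Proof.
rewrite /sqn /dot expr2 mulr_suml; apply: ler_sum => j _.
apply: le_trans (ler_norm _) _; rewrite normrM ler_wpM2l//.
by rewrite (bigD1 j)//= lerDl; exact: sumr_ge0.
Qed.

Lemma mx_measurable_gradient d (f : 'rV[R]_d -> R) L (x : T -> 'rV[R]_d) :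
  0 < L -> smooth L f -> mx_measurable x ->
  mx_measurable (fun w => gradient f (x w)).
Proof.
move=> L0 sf mx i j; rewrite (ord1 i).
apply: (@measurable_lipschitz d (fun y => gradient f y ord0 j) L) => // y z.
rewrite -lerBlDl; apply: le_trans (ler_norm _) _.
set S := \sum_k _.
have S0 : 0 <= S by exact: sumr_ge0.
rewrite -[leLHS]sqrtr_sqr -[leRHS]ger0_norm ?mulr_ge0 ?(ltW L0)//.
rewrite -sqrtr_sqr ler_wsqrtr// exprMn.
apply: le_trans (le_trans (smooth_sqn y z L0 sf) _); last first.
  rewrite ler_wpM2l ?sqr_ge0//; apply: le_trans (sqn_le_sqr_sum _) _.
  by rewrite /S; under eq_bigr do rewrite !mxE.
rewrite /sqn /dot (bigD1 j)//= !mxE expr2 lerDl.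
by apply: sumr_ge0 => k _; rewrite -expr2 sqr_ge0.
Qed.

Lemma mx_measurable_gradientF n d (f : 'I_n -> 'rV[R]_d -> R) L
    (X : T -> 'M[R]_(n, d)) : 0 < L -> (forall i, smooth L (f i)) ->
  mx_measurable X -> mx_measurable (fun w => gradientF f (X w)).
Proof.
move=> L0 sf mX i j.
have := mx_measurable_gradient L0 (sf i) (mx_measurable_row i mX) ord0 j.
by apply: eq_measurable_fun => w _; rewrite /gradientF [RHS]mxE.
Qed.

End EntrywiseMeasurability.

Lemma mx_measurable_of_measurable {R : realType} dT (T : measurableType dT) p q
    (M : T -> 'M[R]_(p, q)) : measurable_fun setT M -> mx_measurable M.
Proof.
move=> mM i j.
apply: (@measurableT_comp _ _ _ _ _ _ (fun N : 'M[R]_(p, q) => N i j)) => //.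
move=> _ U mU; rewrite setTI; apply: sub_sigma_algebra.
by exists i, j, U.
Qed.
(** * Freezing the past *)

Section Independence.
Context {R : realType}.
Local Open Scope ereal_scope.

(** Both sides of the product rule are finite measures of [A]. *)
Lemma product_rule_generated dT (T : measurableType dT) (P : probability T R)
    (G : set (set T)) (B : set T) :
  setI_closed G -> G setT -> G `<=` measurable -> measurable B ->
  (forall A, G A -> P (A `&` B) = P A * P B) ->
  forall A, <<s G >> A -> P (A `&` B) = P A * P B.
Proof.
move=> GI GT Gm mB GB A sA.
pose c : {nonneg R} := NngNum (fine_ge0 (measure_ge0 P B)).
have cE : c%:num%:E = P B by rewrite /= fineK// fin_num_measure.
have := @g_sigma_algebra_measure_unique _ _ _ G Gm (fun=> setT) (fun=> GT) _
  (mrestr P mB) (mscale c P) GI.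
rewrite /= /mrestr /mscale cE => h; rewrite [RHS]muleC; apply: h => //.
- by apply/seteqP; split => // x _; exists 0%N.
- by move=> C GC; rewrite GB// muleC.
- by move=> _; rewrite setTI (le_lt_trans (probability_le1 _ _))// ltry.
Qed.

(** Two independent random elements have the product law, so that integrating a
    function of both may be done over the second one first; the second one may
    then be replaced by an equidistributed copy. *)
Lemma independent_integral dT (T : measurableType dT) (P : probability T R)
    dS (S : measurableType dS) dE (E : measurableType dE)
    (X : {mfun T >-> S}) (Z Z' : {mfun T >-> E}) (phi : S * E -> \bar R) :
  (forall A B, measurable A -> measurable B ->
    P (X @^-1` A `&` Z @^-1` B) = P (X @^-1` A) * P (Z @^-1` B)) ->
  (forall B, measurable B -> P (Z @^-1` B) = P (Z' @^-1` B)) ->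
  measurable_fun setT phi -> (forall x, 0 <= phi x) ->
  \int[P]_w phi (X w, Z w) = \int[P]_w \int[P]_w' phi (X w, Z' w').
Proof.
move=> indep ZZ' mphi phi0.
have mXZ : measurable_fun setT (fun w => (X w, Z w)) by exact/measurable_fun_pair.
pose XZ : {mfun T >-> (S * E)%type} :=
  HB.pack (fun w => (X w, Z w)) (isMeasurableFun.Build _ _ _ _ _ mXZ).
have -> : \int[P]_w phi (X w, Z w) = \int[distribution P XZ]_x phi x.
  by rewrite ge0_integral_distribution.
have -> : \int[distribution P XZ]_x phi x =
    \int[distribution P X \x distribution P Z']_x phi x.
  apply: eq_measure_integral => A mA _; apply/esym.
  apply: product_measure_unique => // B C mB mC.
  by transitivity (P (X @^-1` B) * P (Z @^-1` C)); [rewrite -indep|rewrite ZZ'].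
rewrite fubini_tonelli1// ge0_integral_distribution//=.
- apply: eq_integral => w _; rewrite /fubini_F ge0_integral_distribution//.
  by apply: measurableT_comp => //; exact: measurable_pair1.
- exact: measurable_fun_fubini_tonelli_F.
- by move=> x; exact: integral_ge0.
Qed.

(** Finite intersections of events on the first [k] variables form a pi-system;
    the sigma-algebra that it generates is the past at time [k]. *)
Section Past.
Context dT (T : measurableType dT) (P : probability T R).
Context dE (E : measurableType dE) (Z : nat -> {mfun T >-> E}).

Definition past_events (k : nat) : set (set T) :=
  [set A | exists F : nat -> set E, (forall i, measurable (F i)) /\
    A = \big[setI/setT]_(i <- iota 0 k) (Z i @^-1` F i)].

Definition past (k : nat) := g_sigma_algebraType (past_events k).

Lemma measurable_RV_preimage i (B : set E) : measurable B ->
  measurable (Z i @^-1` B).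
Proof. by move=> mB; rewrite -[X in measurable X]setTI; exact: measurable_funPT. Qed.

Lemma past_eventsT k : past_events k setT.
Proof.
exists (fun=> setT); split => //.
by rewrite big1_seq// => i _; rewrite preimage_setT.
Qed.

Lemma past_eventsI k : setI_closed (past_events k).
Proof.
move=> A B [F [mF ->]] [F' [mF' ->]]; exists (fun i => F i `&` F' i); split.
  by move=> i; exact: measurableI.
by rewrite -big_split; apply: eq_bigr => i _; rewrite preimage_setI.
Qed.

Lemma past_events_measurable k : past_events k `<=` measurable.
Proof.
move=> _ [F [mF ->]]; elim/big_rec: _ => // i A _ mA.
by apply: measurableI => //; exact: measurable_RV_preimage.
Qed.

Lemma past_measurable k A : <<s past_events k >> A -> measurable A.
Proof.
apply: smallest_sub; last exact: past_events_measurable.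
exact: sigma_algebra_measurable.
Qed.

Lemma past_eventsS k : past_events k `<=` past_events k.+1.
Proof.
move=> _ [F [mF ->]]; exists (fun i => if (i < k)%N then F i else setT); split.
  by move=> i; case: ifP.
rewrite -(addn1 k) iotaD big_cat big_seq1 /= add0n ltnn preimage_setT setIT.
apply: eq_big_seq => i; rewrite mem_iota => /andP[_].
by rewrite add0n => ->.
Qed.

Lemma measurable_fun_past k dU (U : measurableType dU) (g : T -> U) :
  measurable_fun [set: past k] g -> measurable_fun [set: past k.+1] g.
Proof.
move=> mg mT B mB; have := mg measurableT B mB; rewrite !setTI.
by apply: sub_smallest2r; [exact: smallest_sigma_algebra|exact: past_eventsS].
Qed.

Lemma measurable_fun_past_last k : measurable_fun [set: past k.+1] (Z k).
Proof.
move=> _ B mB; rewrite setTI; apply: sub_sigma_algebra.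
exists (fun i => if i == k then B else setT); split.
  by move=> i; case: ifP.
rewrite -(addn1 k) iotaD big_cat big_seq1 /= add0n eqxx big1_seq ?setTI//.
move=> i /andP[_]; rewrite mem_iota add0n => /andP[_ ik].
by rewrite ltn_eqF// preimage_setT.
Qed.

Hypothesis indep : mutually_independent P (fun k w => Z k w).

(** An event on the first [k] variables does not constrain the next one, so
    adjoining [B] as the constraint on that variable gives again an intersection
    to which mutual independence applies. *)
Lemma past_independent k A B : <<s past_events k >> A -> measurable B ->
  P (A `&` Z k @^-1` B) = P A * P (Z k @^-1` B).
Proof.
move=> sA mB; apply: product_rule_generated sA.
- exact: past_eventsI.
- exact: past_eventsT.
- exact: past_events_measurable.
- exact: measurable_RV_preimage.
move=> _ [F [mF ->]].
have mF' i : measurable ((fun i => if i == k then B else F i) i).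
  by case: ifP.
have := indep _ mF'.
move=> h; have := h (iota 0 k.+1) (iota_uniq _ _).
have := h (iota 0 k) (iota_uniq _ _).
rewrite -(addn1 k) iotaD !big_cat !big_seq1 /= add0n eqxx.
have -> : \big[setI/[set: T]]_(i <- iota 0 k)
    ((fun w => Z i w) @^-1` (if i == k then B else F i)) =
    \big[setI/[set: T]]_(i <- iota 0 k) (Z i @^-1` F i).
  apply: eq_big_seq => i; rewrite mem_iota add0n => /andP[_ ik].
  by rewrite ltn_eqF.
by move=> <- ->.
Qed.

Hypothesis equidist : identically_distributed P (fun k w => Z k w).

(** The inner integral over the next variable is taken with the past fixed, and over
    the law of the first variable, so that one-step estimates are needed for that
    variable only. *)
Lemma past_integral k (phi : past k * E -> \bar R) :
  measurable_fun setT phi -> (forall x, 0 <= phi x) ->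
  \int[P]_w phi (w, Z k w) = \int[P]_w \int[P]_w' phi (w, Z 0%N w').
Proof.
move=> mphi phi0.
have mid : measurable_fun [set: T] (id : T -> past k).
  by move=> _ B mB; rewrite setTI; exact: (past_measurable mB).
pose X : {mfun T >-> past k} :=
  HB.pack (id : T -> past k) (isMeasurableFun.Build _ _ _ _ _ mid).
apply: (@independent_integral _ _ P _ _ _ _ X (Z k) (Z 0%N)) => //.
- by move=> A B mA mB; exact: (past_independent mA mB).

- by move=> B mB; exact: (equidist k 0%N mB).
Qed.

End Past.
End Independence.
(** * One step from a fixed state *)

Section OneStep.
Context {R : realType} {n d : nat}.
Variables (f : 'I_n -> 'rV[R]_d -> R) (eta : R) (xs : 'rV[R]_d).
Hypothesis n0 : (0 < n)%N.
Implicit Types (S : {set 'I_n}) (A B : 'M[R]_n) (X Y C Z : 'M[R]_(n, d)).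

Let n0' : (0 : R) < n%:R. Proof. by rewrite ltr0n. Qed.

Definition active (S : {set 'I_n}) (i : 'I_n) : R := (i \in S)%:R.

Lemma row_active_mul S Z i : row i (active_mx S *m Z) = active S i *: row i Z.
Proof. by apply/rowP => j; rewrite /active_mx mul_diag_mx !mxE. Qed.

Lemma active_sqr S i : active S i ^+ 2 = active S i.
Proof. by rewrite /active; case: (i \in S); rewrite ?expr1n ?expr0n. Qed.

Lemma active_mx_idem S : active_mx S *m active_mx S = active_mx S :> 'M[R]_n.
Proof.
apply/matrixP => i j; rewrite mul_diag_mx !mxE mulrnAr -expr2.
by have := active_sqr S i; rewrite /active => ->.
Qed.

Lemma sqfro_active S Z :
  sqfro (active_mx S *m Z) = \sum_i active S i * sqn (row i Z).
Proof.
by apply: eq_bigr => i _; rewrite row_active_mul sqnZ active_sqr.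
Qed.

Definition direction (s : ppds_state R n d) : 'M[R]_(n, d) :=
  st_Y s + gradF_diff f (st_X s) (st_C s).

Lemma active_direction S s :
  active_mx S *m (st_Y s + active_mx S *m gradF_diff f (st_X s) (st_C s)) =
  active_mx S *m direction s.
Proof.
rewrite /direction; set D := gradF_diff _ _ _.
by rewrite [LHS]mulmxDr [RHS]mulmxDr mulmxA active_mx_idem.
Qed.

(** The invariant that makes the expected direction the mean current gradient. *)
Definition tracking (s : ppds_state R n d) : Prop :=
  rmean (st_Y s) = rmean (gradientF f (st_C s)).

Lemma row_step_C S X C i : row i (active_mx S *m X + (1%:M - active_mx S) *m C) =
  if i \in S then row i X else row i C.
Proof.
rewrite linearD /= mulmxBl linearB /= mul1mx. rewrite !row_active_mul /active.
by case: ifP => _; rewrite ?scale1r ?scale0r ?add0r ?subr0// subrr addr0.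
Qed.

(** Refreshing the stored points changes the stored gradients by exactly the
    increment that the trackers receive. *)
Lemma gradientF_step_C S X C :
  gradientF f (active_mx S *m X + (1%:M - active_mx S) *m C) =
  gradientF f C + active_mx S *m gradF_diff f X C.
Proof.
apply/row_matrixP => i; rewrite linearD /= row_active_mul linearB /=.
rewrite !row_gradientF row_step_C /active; case: ifP => _.
  by rewrite scale1r addrC subrK.
by rewrite scale0r addr0.
Qed.

Lemma tracking_step S A B s : doubly_stochastic B -> tracking s ->
  tracking (ppds_step f eta S A B s).
Proof.
case=> _ _ Bc; rewrite /tracking /= rmean_stochastic// gradientF_step_C.
by rewrite !rmeanD => ->.
Qed.

(** Stated for an arbitrary active set, so that both sums are linear in the
    activity indicators and can be averaged term by term. *)
Lemma dist_step_le S A B s : doubly_stochastic A ->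
  n%:R * sqn (rmean (st_X (ppds_step f eta S A B s)) - xs) <=
  n%:R * sqn (rmean (st_X s) - xs)
  - 2 * eta * \sum_i active S i * dot (row i (direction s)) (rmean (st_X s) - xs)
  + eta ^+ 2 * (#|S|%:R / n%:R) * \sum_i active S i * sqn (row i (direction s)).
Proof.
case=> _ _ Ac; rewrite /= rmean_stochastic// active_direction.
set z := rmean (st_X s) - xs; set G := direction s.
rewrite rmeanD rmeanN addrAC -/z.
have -> : rmean (eta *: (active_mx S *m G)) =
    (eta / n%:R) *: \sum_i active S i *: row i G.
  rewrite rmeanE [LHS]scaler_sumr [RHS]scaler_sumr; apply: eq_bigr => i _.
  rewrite -row_active_mul -scalerA; apply/rowP => j; rewrite !mxE; ring.
rewrite sqnB sqnZ dotZr dot_sumr.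
have -> : \sum_i dot z (active S i *: row i G) =
    \sum_i active S i * dot (row i G) z.
  by apply: eq_bigr => i _; rewrite dotZr dotC.
set T := \sum_i active S i * dot _ _.
have := sqn_sum_le_card S (fun i => row i G).
rewrite -[\sum_i (i \in S)%:R *: _]/(\sum_i active S i *: row i G).
rewrite -[\sum_i (i \in S)%:R * _]/(\sum_i active S i * sqn (row i G)).
set Q := sqn (\sum_i _); set q := \sum_i _ * sqn _ => hQ.
have -> : n%:R * (sqn z - 2 * (eta / n%:R * T) + (eta / n%:R) ^+ 2 * Q) =
    n%:R * sqn z - 2 * eta * T + eta ^+ 2 / n%:R * Q.
  by field; rewrite gt_eqF.
have -> : eta ^+ 2 * (#|S|%:R / n%:R) * q = eta ^+ 2 / n%:R * (#|S|%:R * q).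
  by ring.
by rewrite lerD2l ler_wpM2l// divr_ge0 ?sqr_ge0// ltW.
Qed.

Lemma spread_X_step_le r S A B s : 0 < r < 1 -> doubly_stochastic A ->
  spread (st_X (ppds_step f eta S A B s)) <=
  r^-1 * qform (A^T *m centering *m A) (centering *m st_X s) +
  (1 - r)^-1 * eta ^+ 2 * \sum_i active S i * sqn (row i (direction s)).
Proof.
move=> r01 dA; rewrite /= active_direction.
apply: le_trans (spread_mix_le n0 _ _ r01 dA) _.
by rewrite lerD2l -scaleNr sqfroZ sqrrN sqfro_active mulrA.
Qed.

Lemma spread_Y_step_le r S A B s : 0 < r < 1 -> doubly_stochastic B ->
  spread (st_Y (ppds_step f eta S A B s)) <=
  r^-1 * qform (B^T *m centering *m B) (centering *m st_Y s) +
  (1 - r)^-1 * \sum_i active S i * sqn (row i (gradF_diff f (st_X s) (st_C s))).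
Proof.
move=> r01 dB; apply: le_trans (spread_mix_le n0 _ _ r01 dB) _.
by rewrite sqfro_active.
Qed.

Lemma grad_dev_step S A B s :
  grad_dev f xs (st_C (ppds_step f eta S A B s)) =
  grad_dev f xs (st_C s) + \sum_i active S i *
   (sqn (gradient (f i) (row i (st_X s)) - gradient (f i) xs) -
    sqn (gradient (f i) (row i (st_C s)) - gradient (f i) xs)).
Proof.
rewrite /grad_dev -big_split; apply: eq_bigr => i _ /=; rewrite row_step_C.
by rewrite /active; case: ifP => _; rewrite ?mul1r ?mul0r ?addr0// addrC subrK.
Qed.

Definition lyapunov (U V W : R) (s : ppds_state R n d) : R :=
  n%:R * sqn (rmean (st_X s) - xs) + U * spread (st_X s) + V * spread (st_Y s)
  + W * grad_dev f xs (st_C s).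

Lemma lyapunov_ge0 U V W s : 0 <= U -> 0 <= V -> 0 <= W ->
  0 <= lyapunov U V W s.
Proof.
move=> U0 V0 W0; rewrite /lyapunov !addr_ge0// mulr_ge0 ?ler0n ?sqn_ge0//;
  [exact: spread_ge0|exact: spread_ge0|exact: grad_dev_ge0].
Qed.

Lemma sqn_row_le_lyapunov U V W s i : 0 < U -> 0 <= V -> 0 <= W ->
  sqn (row i (st_X s) - xs) <= (1 + U^-1) * lyapunov U V W s.
Proof.
move=> U0 V0 W0; apply: (@le_trans _ _ (\sum_i sqn (row i (st_X s) - xs))).
  by rewrite (bigD1 i)//= lerDl sumr_ge0// => j _; exact: sqn_ge0.
rewrite spread_shift// /lyapunov; set a := n%:R * _; set u := spread _.
have a0 : 0 <= a by rewrite mulr_ge0 ?ler0n ?sqn_ge0.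
have u0 : 0 <= u by exact: spread_ge0.
have vw : 0 <= V * spread (st_Y s) + W * grad_dev f xs (st_C s).
  by rewrite addr_ge0// mulr_ge0 ?spread_ge0 ?grad_dev_ge0.
have Ui : 0 < U^-1 by rewrite invr_gt0.
have uE : u = U^-1 * (U * u) by rewrite mulKf// gt_eqF.
rewrite {1}uE; set y := U * u; have y0 : 0 <= y by rewrite mulr_ge0// ltW.
rewrite -addrA mulrDl mul1r; have := mulr_ge0 (ltW Ui) vw.
have := mulr_ge0 (ltW Ui) a0; have := mulr_ge0 (ltW Ui) y0; lra.
Qed.

End OneStep.

Section StepMeasurability.
Context {R : realType} {dT : measure_display} {T : measurableType dT}.
Context {n d : nat}.
Variables (f : 'I_n -> 'rV[R]_d -> R) (eta L : R) (xs : 'rV[R]_d).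
Hypotheses (L0 : 0 < L) (sf : forall i, smooth L (f i)).

Definition state_measurable (s : T -> ppds_state R n d) : Prop :=
  [/\ mx_measurable (fun w => st_X (s w)), mx_measurable (fun w => st_Y (s w)) &
      mx_measurable (fun w => st_C (s w))].

Lemma state_measurable_step (s : T -> ppds_state R n d)
    (V : T -> {set 'I_n}) (A B : T -> 'M[R]_n) :
  state_measurable s -> measurable_fun setT V -> mx_measurable A ->
  mx_measurable B ->
  state_measurable (fun w => ppds_step f eta (V w) (A w) (B w) (s w)).
Proof.
move=> [mX mY mC] mV mA mB.
have mD := mx_measurable_active (R := R) mV.
have mY2 : mx_measurable (fun w => st_Y (s w) + active_mx (V w) *m
    (gradientF f (st_X (s w)) - gradientF f (st_C (s w)))).
  apply: mx_measurableD => //; apply: mx_measurableM => //.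
  by apply: mx_measurableB; exact: (mx_measurable_gradientF L0 sf).
split=> /=.
- apply: mx_measurableM => //; apply: mx_measurableB => //.
  by apply: mx_measurableZ; exact: mx_measurableM.
- exact: mx_measurableM.
- apply: mx_measurableD; apply: mx_measurableM => //.
  by apply: mx_measurableB => //; exact: mx_measurable_cst.
Qed.

Lemma measurable_lyapunov U V W (s : T -> ppds_state R n d) :
  state_measurable s ->
  measurable_fun [set: T] (fun w => lyapunov f xs U V W (s w)).
Proof.
move=> [mX mY mC].
have mcst (p q : nat) (M : 'M[R]_(p, q)) := @mx_measurable_cst R _ T p q M.
have mZ a (g : T -> R) : measurable_fun setT g ->
    measurable_fun setT (fun w => a * g w).
  by move=> mg; apply: measurable_funM => //; exact: measurable_cst.
apply: measurable_funD; [apply: measurable_funD; [apply: measurable_funD|]|];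
  apply: mZ.
- apply/measurable_sqn/mx_measurableB => //.
  by apply: mx_measurableZ; exact: mx_measurableM.
- by apply/measurable_sqfro/mx_measurableM.
- by apply/measurable_sqfro/mx_measurableM.
apply: measurable_sum => i; apply/measurable_sqn/mx_measurableB => //.
exact/(mx_measurable_gradient L0 (sf i))/mx_measurable_row.
Qed.

End StepMeasurability.
(** * Expectation of one step *)

Section Means.
Context {R : realType} {dT : measure_display} {T : measurableType dT}.
Variable P : probability T R.
Local Open Scope ereal_scope.

(** Integrability is bundled with the value so that means of affine combinations
    are computed by following the syntax. *)
Definition has_mean (g : T -> R) (r : R) : Prop :=
  P.-integrable setT (EFin \o g) /\ \int[P]_w (g w)%:E = r%:E.

Lemma integral_cst_probability r : \int[P]_w r%:E = r%:E.
Proof.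
rewrite (integral_cst P measurableT r%:E) [X in _ * X](_ : _ = 1) ?mule1//.
exact: probability_setT.
Qed.

Lemma has_mean_cst r : has_mean (fun=> r) r.
Proof.
split; first exact: finite_measure_integrable_cst.
exact: integral_cst_probability.
Qed.

Lemma has_meanD g h r s : has_mean g r -> has_mean h s ->
  has_mean (fun w => g w + h w)%R (r + s)%R.
Proof.
move=> [ig eg] [ih eh]; split; first exact: (integrableD measurableT ig ih).
rewrite (_ : (fun _ => _) = (fun w => (EFin \o g) w + (EFin \o h) w))//.
by rewrite (integralD measurableT ig ih) eg eh.
Qed.

Lemma has_meanZ a g r : has_mean g r -> has_mean (fun w => a * g w)%R (a * r)%R.
Proof.
move=> [ig eg]; split; first exact: (integrableZl measurableT a ig).
rewrite (_ : (fun _ => _) = (fun w => a%:E * (EFin \o g) w))//.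
by rewrite (integralZl measurableT ig) eg.
Qed.

Lemma has_meanM a g r : has_mean g r -> has_mean (fun w => g w * a)%R (r * a)%R.
Proof.
move=> /(has_meanZ a); rewrite mulrC.
by under eq_fun do rewrite mulrC.
Qed.

Lemma has_mean_sum (I : finType) (g : I -> T -> R) (r : I -> R) :
  (forall i, has_mean (g i) (r i)) ->
  has_mean (fun w => \sum_i g i w)%R (\sum_i r i)%R.
Proof.
move=> h; elim: (index_enum I) => [|i s IH].
  by rewrite big_nil; under eq_fun do rewrite big_nil; exact: has_mean_cst.
by rewrite big_cons; under eq_fun do rewrite big_cons; exact: has_meanD.
Qed.

Lemma has_mean_bounded (g : T -> R) (K : R) : measurable_fun setT g ->
  {ae P, forall w, `|g w| <= K}%R -> has_mean g (fine (\int[P]_w (g w)%:E)).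
Proof.
move=> mg gK; have ig : P.-integrable setT (EFin \o g).
  apply/integrableP; split; first exact/measurable_EFinP.
  apply: (@le_lt_trans _ _ (\int[P]_w `|K|%:E)).
    apply: ae_ge0_le_integral => //.
    - by apply: measurableT_comp => //; exact/measurable_EFinP.
    - by apply: filterS gK => w gw _; rewrite lee_fin (le_trans gw)// ler_norm.
  by rewrite integral_cst_probability ltry.
by split => //; rewrite fineK//; exact: integrable_fin_num.
Qed.

(** The bound [h] may be negative on the null set where the inequality fails, hence
    the passage through its absolute value. *)
Lemma integral_le_mean (g h : T -> R) r : measurable_fun setT g ->
  (forall w, 0 <= g w)%R -> {ae P, forall w, g w <= h w}%R -> has_mean h r ->
  \int[P]_w (g w)%:E <= r%:E.
Proof.
move=> mg g0 gh [ih <-].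
have mh : measurable_fun setT (EFin \o h) by have /integrableP[] := ih.
have mah : measurable_fun setT (fun w => `|(EFin \o h) w|) by exact: measurableT_comp.
rewrite [leRHS](@ae_eq_integral _ _ _ P setT (fun w => `|(EFin \o h) w|))//;
  last first.
  apply: filterS gh => w gw _ /=.
  by rewrite ger0_norm// (le_trans (g0 w)).
apply: ae_ge0_le_integral => //.
- by move=> w _; rewrite lee_fin.
- exact/measurable_EFinP.
by apply: filterS gh => w gw _; rewrite lee_fin (le_trans gw)// ler_norm.
Qed.

End Means.

Section UniformActivity.
Context {R : realType} {dT : measure_display} {T : measurableType dT}.
Variable P : probability T R.
Context {n : nat} (m : nat) (V : {mfun T >-> {set 'I_n}}).
Hypothesis uniV : uniform_subset P m V.

(** Pascal's rule: the other subsets of size [m] avoid [i]. *)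
Lemma card_draws_containing (i : 'I_n) : (0 < m)%N ->
  #|[set S : {set 'I_n} | (i \in S) && (#|S| == m)]%SET| = 'C(n.-1, m.-1).
Proof.
move=> m0; have n0 : (0 < n)%N by apply: leq_ltn_trans (ltn_ord i).
have := cards_draws [set~ i]%SET m; rewrite cardsC1 card_ord => c1.
have := card_draws 'I_n m; rewrite card_ord => c2.
have split : #|[set S : {set 'I_n} | #|S| == m]%SET| =
    (#|[set S : {set 'I_n} | (i \in S) && (#|S| == m)]%SET| +
    #|[set S : {set 'I_n} | S \subset [set~ i]%SET & #|S| == m]%SET|)%N.
  rewrite -[LHS](cardsID [set S : {set 'I_n} | i \in S]%SET); congr (_ + _)%N.
    by apply: eq_card => S; rewrite !finset.inE andbC.
  apply: eq_card => S; rewrite !finset.inE; congr (_ && _).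
  by rewrite finset.subsets_disjoint finset.setCK disjoint_sym finset.disjoints1.
move: split; rewrite c1 c2; move: #|_| => N.
rewrite -{1 2}(prednK n0) -{1 2}(prednK m0) binS prednK// addnC.
by move=> /addIn.
Qed.

(** Decompose the indicator over the values of the random subset. *)
Lemma has_mean_active i : (0 < m <= n)%N ->
  has_mean P (fun w => active (V w) i) (m%:R / n%:R).
Proof.
case/andP => m0 mn; have n0 : (0 < n)%N by exact: leq_trans mn.
have mV S : measurable (V @^-1` [set S]).
  by rewrite -[X in measurable X]setTI; exact: measurable_funPT.
have meanS S : has_mean P (\1_(V @^-1` [set S]) : T -> R)
    (if #|S| == m then 'C(n, m)%:R^-1 else 0).
  split; first exact: integrable_indic.
  by rewrite integral_indic// setIT; exact: uniV.
have := has_mean_sum (fun S => has_meanZ (active S i) (meanS S)).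
have -> : (fun w => \sum_S active S i * \1_(V @^-1` [set S]) w) =
    (fun w => active (R := R) (V w) i).
  apply/funext => w; rewrite (bigD1 (V w))//= big1 ?addr0.
    by rewrite indicE mem_set ?mulr1.
  move=> S SV; rewrite indicE memNset ?mulr0// => VS.
  by move/eqP: SV; apply; rewrite VS.
congr has_mean.
have -> : \sum_(S : {set 'I_n}) active S i * (if #|S| == m then 'C(n, m)%:R^-1 else 0) =
    \sum_(S in [set S : {set 'I_n} | (i \in S) && (#|S| == m)]%SET) 'C(n, m)%:R^-1 :> R.
  rewrite [RHS]big_mkcond; apply: eq_bigr => S _; rewrite finset.inE /active.
  by case: (i \in S); case: (_ == _); rewrite ?mul1r ?mul0r.
rewrite sumr_const card_draws_containing// -(mulr_natl 'C(n, m)%:R^-1).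
have nm : (n * 'C(n.-1, m.-1) = m * 'C(n, m))%N.
  by case: (n) (m) n0 m0 => [//|n'] [//|m'] _ _; exact: mul_bin_diag.
apply/eqP; rewrite eqr_div ?pnatr_eq0 -?lt0n ?bin_gt0//.
by rewrite -!natrM eqr_nat mulnC nm mulnC.
Qed.

Lemma ae_card_active : {ae P, forall w, #|V w| = m}.
Proof.
have : {ae P, forall w, forall S : {set 'I_n}, #|S| != m -> V w != S}.
  apply: filter_forall => S; have [Sm|Sm] := boolP (#|S| == m); first exact: aeW.
  exists (V @^-1` [set S]); split.
  - by rewrite -[X in measurable X]setTI; exact: measurable_funPT.
  - by have := uniV S; rewrite (negbTE Sm).
  - by move=> w /= /not_implyP[_ /negP]; rewrite negbK => /eqP.
apply: filterS => w h; apply/eqP; apply: contraT => /h.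
by rewrite eqxx.
Qed.

End UniformActivity.

Section MeanMixing.
Context {R : realType} {dT : measure_display} {T : measurableType dT}.
Variable P : probability T R.
Context {n : nat} (A : {mfun T >-> 'M[R]_n}).
Hypothesis n0 : (0 < n)%N.
Hypothesis dsA : {ae P, forall w, doubly_stochastic (A w)}.

Let M w := (A w)^T *m centering *m A w.

Lemma has_mean_mixing_entry i j :
  has_mean P (fun w => M w i j) (expectation_mx P M i j).
Proof.
rewrite mxE unlock; apply: (has_mean_bounded (K := \sum_k \sum_l `|centering k l|)).
  have mA := mx_measurable_of_measurable (@measurable_funPT _ _ _ _ A).
  apply: mx_measurableM => //; apply: mx_measurableM; last exact: mx_measurable_cst.
  exact: mx_measurable_tr.
apply: filterS dsA => w dA; have [A0 _ _] := dA.
rewrite /M -mulmxA mxE; apply: le_trans (ler_norm_sum _ _ _) _.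
apply: ler_sum => k _; rewrite mxE normrM mxE.
rewrite -[leRHS]mul1r; apply: ler_pM => //.
  by rewrite ger0_norm ?A0//; exact: doubly_stochastic_le1.
apply: le_trans (ler_norm_sum _ _ _) _.
apply: ler_sum => l _; rewrite normrM -[leRHS]mulr1 ler_wpM2l//.
by rewrite ger0_norm ?A0//; exact: doubly_stochastic_le1.
Qed.

Lemma has_mean_qform d (Z : 'M[R]_(n, d)) :
  has_mean P (fun w => qform (M w) Z) (qform (expectation_mx P M) Z).
Proof.
by apply: has_mean_sum => i; apply: has_mean_sum => j; apply: has_meanM;
  exact: has_mean_mixing_entry.
Qed.

Lemma mixing_ge0 : 0 <= mixing P A.
Proof. exact: spectral_radius_ge0. Qed.

Lemma mean_qform_le d (Z : 'M[R]_(n, d)) :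
  qform (expectation_mx P M) Z <= mixing P A * sqfro Z.
Proof.
apply: qform_le_spectral_radius; apply/matrixP => i j; rewrite !mxE.
suff -> : (fun w => M w j i) = (fun w => M w i j) by [].
apply/funext => w; have MT : (M w)^T = M w.
  by rewrite /M !trmx_mul trmxK trmx_centering mulmxA.
by rewrite -{1}MT mxE.
Qed.

End MeanMixing.
Section MeanStep.
Context {R : realType} {dT : measure_display} {T : measurableType dT}.
Variable P : probability T R.
Context {n d : nat}.
Variables (m : nat) (f : 'I_n -> 'rV[R]_d -> R) (eta L mu rho : R).
Variables (xs : 'rV[R]_d).
Variables (V : {mfun T >-> {set 'I_n}}) (A B : {mfun T >-> 'M[R]_n}).
Hypotheses (mn : (1 <= m <= n)%N) (d0 : (0 < d)%N).
Hypotheses (L0 : 0 < L) (cf : forall i, convex (f i)).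
Hypotheses (sf : forall i, smooth L (f i)).
Hypotheses (mu0 : 0 < mu) (scf : strongly_convex mu (average f)).
Hypothesis minf : minimizer (average f) xs.
Hypothesis ds :
  {ae P, forall w, doubly_stochastic (A w) /\ doubly_stochastic (B w)}.
Hypothesis uniV : uniform_subset P m V.

Let lam := Num.max (mixing P A) (mixing P B).
Let k := 1 - lam.
Let p : R := m%:R / n%:R.

Hypotheses (lam1 : lam < 1) (eta0 : 0 < eta).
Hypotheses (step1 : eta * L * Num.sqrt p <= k ^+ 2 / 14)
  (step2 : eta * L * Num.sqrt p * p <= k ^+ 2 / 2304)
  (step3 : eta * L * Num.sqrt p <= 1 / 576).
Hypotheses (rho_a : 1 - eta * mu * p / 2 <= rho) (rho_c : 1 - p / 4 <= rho).

Let n0 : (0 < n)%N. Proof. by case/andP: mn; exact: leq_trans. Qed.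
Let n0' : (0 : R) < n%:R. Proof. by rewrite ltr0n. Qed.

Let lam0 : 0 <= lam.
Proof. by rewrite /lam le_max; apply/orP; left; exact: mixing_ge0. Qed.

Let lamA : mixing P A <= lam.
Proof. by rewrite /lam le_max; apply/orP; left; exact: lexx. Qed.
Let lamB : mixing P B <= lam.
Proof. by rewrite /lam le_max; apply/orP; right; exact: lexx. Qed.

Let k01 : 0 < k <= 1.
Proof. by rewrite subr_gt0 lam1 lerBlDr lerDl lam0. Qed.

Let p01 : 0 < p <= 1.
Proof.
case/andP: mn => m0 hmn; rewrite divr_gt0 ?ltr0n//.
by rewrite ler_pdivrMr// mul1r ler_nat.
Qed.

(* the weight of the mixed term in the triangle inequality: [lam / r <= 1 - k / 2]
   and [1 / (1 - r) = 2 / k] *)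
Let r := 1 - k / 2.
Let r01 : 0 < r < 1.
Proof. by case/andP: k01 => k0 k1; rewrite /r; apply/andP; split; lra. Qed.

Let dsA : {ae P, forall w, doubly_stochastic (A w)}.
Proof. by apply: filterS ds => w []. Qed.
Let dsB : {ae P, forall w, doubly_stochastic (B w)}.
Proof. by apply: filterS ds => w []. Qed.

Let mix_le x (y : R) : 0 <= y -> x <= lam * y -> r^-1 * x <= (1 - k / 2) * y.
Proof.
move=> y0 xy; case/andP: r01 => r0 r1; rewrite ler_pdivrMl//.
apply: le_trans xy _; rewrite mulrA ler_wpM2r//.
by have := sqr_ge0 k; rewrite /r /k; lra.
Qed.

Let U := coef_U eta L p k.
Let cV := coef_V eta L p k.
Let W := coef_W eta L p k.

(** The bounds of one step are affine in the indicators of activity and in the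
    entries of [A^T (I - J) A] and [B^T (I - J) B], without any product of the two
    kinds, so their means follow by linearity although these random variables may
    depend on each other. *)
Lemma mean_lyapunov_step (s : ppds_state R n d) : tracking f s ->
  (\int[P]_w (lyapunov f xs U cV W
     (ppds_step f eta (V w) (A w) (B w) s))%:E <=
   (rho * lyapunov f xs U cV W s)%:E)%E.
Proof.
move=> track; case/andP: (k01) => k0 k1; case/andP: (p01) => p0 p1.
have muL := strong_convexity_le_smoothness n0 L0 sf scf minf d0.
have U0 : 0 <= U by rewrite ltW// coef_U_gt0.
have V0 : 0 <= cV by exact: coef_V_ge0.
have W0 : 0 <= W by exact: coef_W_ge0.
set G := direction f s; set D := gradF_diff f (st_X s) (st_C s).
set z := rmean (st_X s) - xs.
pose act (c : 'I_n -> R) w := \sum_i active (V w) i * c i.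
have mean_act c : has_mean P (act c) (p * \sum_i c i).
  rewrite mulr_sumr; apply: has_mean_sum => i; apply: has_meanM.
  exact: has_mean_active.
pose cG i := sqn (row i G).
pose cD i := sqn (row i D).
pose cz i := dot (row i G) z.
pose cC i := sqn (gradient (f i) (row i (st_X s)) - gradient (f i) xs)
  - sqn (gradient (f i) (row i (st_C s)) - gradient (f i) xs).
pose qA w := qform ((A w)^T *m centering *m A w) (centering *m st_X s).
pose qB w := qform ((B w)^T *m centering *m B w) (centering *m st_Y s).
have [mA hqA mA_le] : exists2 x, has_mean P qA x & x <= lam * spread (st_X s).
  exists (qform (expectation_mx P (fun w => (A w)^T *m centering *m A w))
    (centering *m st_X s)); first exact: has_mean_qform.
  apply: le_trans (mean_qform_le _ _ _) _.
  by apply: ler_wpM2r; [exact: sqfro_ge0|exact: lamA].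
have [mB hqB mB_le] : exists2 x, has_mean P qB x & x <= lam * spread (st_Y s).
  exists (qform (expectation_mx P (fun w => (B w)^T *m centering *m B w))
    (centering *m st_Y s)); first exact: has_mean_qform.
  apply: le_trans (mean_qform_le _ _ _) _.
  by apply: ler_wpM2r; [exact: sqfro_ge0|exact: lamB].
pose bound w :=
  (n%:R * sqn z + - (2 * eta) * act cz w + eta ^+ 2 * p * act cG w)
  + U * (r^-1 * qA w + (1 - r)^-1 * eta ^+ 2 * act cG w)
  + cV * (r^-1 * qB w + (1 - r)^-1 * act cD w)
  + W * (grad_dev f xs (st_C s) + act cC w).
pose mbound :=
  (n%:R * sqn z + - (2 * eta) * (p * \sum_i cz i)
   + eta ^+ 2 * p * (p * \sum_i cG i))
  + U * (r^-1 * mA + (1 - r)^-1 * eta ^+ 2 * (p * \sum_i cG i))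
  + cV * (r^-1 * mB + (1 - r)^-1 * (p * \sum_i cD i))
  + W * (grad_dev f xs (st_C s) + p * \sum_i cC i).
have mean_bound : has_mean P bound mbound.
  by do ![exact: has_mean_cst|exact: mean_act|exact: hqA|exact: hqB
    |apply: has_meanD|apply: has_meanZ].
apply: (@le_trans _ _ mbound%:E).
  apply: integral_le_mean mean_bound.
  - apply: (@measurable_lyapunov _ _ _ _ _ f L xs L0 sf U cV W
      (fun w => ppds_step f eta (V w) (A w) (B w) s)).
    apply: (@state_measurable_step _ _ _ _ _ f eta L L0 sf (fun=> s) V A B).
    + by split; exact: mx_measurable_cst.
    + exact: measurable_funPT.
    + exact/mx_measurable_of_measurable/measurable_funPT.
    + exact/mx_measurable_of_measurable/measurable_funPT.
  - by move=> w; exact: lyapunov_ge0.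
  apply: filterS2 (ae_card_active uniV) ds => w cardV [dA dB].
  rewrite /lyapunov /bound !lerD// ?ler_wpM2l//.
  - by have := dist_step_le f eta xs n0 (V w) (B w) s dA; rewrite cardV mulNr.
  - exact: spread_X_step_le.
  - exact: spread_Y_step_le.
  - by rewrite grad_dev_step.
rewrite lee_fin /mbound.
have sumC : \sum_i cC i = grad_dev f xs (st_X s) - grad_dev f xs (st_C s).
  by rewrite sumrB.
have sumz : \sum_i cz i = \sum_i dot (gradient (f i) (row i (st_X s))) z.
  rewrite -!dot_suml; congr dot.
  have : rmean G = rmean (gradientF f (st_X s)).
    by rewrite /G /direction !rmeanD rmeanN track addrC subrK.
  rewrite !rmeanE => /(scalerI (lt0r_neq0 _)); rewrite invr_gt0 => /(_ n0') ->.
  by apply: eq_bigr => i _; rewrite row_gradientF.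
have r2 : (1 - r)^-1 = 2 / k by rewrite /r; field; rewrite gt_eqF.
pose F := n%:R * gap f xs (rmean (st_X s)).
rewrite /lyapunov -/z.
apply: (lyapunov_contraction eta0 L0 mu0 muL p01 k01 step1 step2 step3 rho_a rho_c
  (g := grad_dev f xs (st_X s)) (F := F) (q := \sum_i cz i) (gam := sqfro G)
  (del := sqfro D)).
- by rewrite mulr_ge0 ?ler0n ?sqn_ge0.
- exact: spread_ge0.
- exact: spread_ge0.
- exact: grad_dev_ge0.
- by rewrite mulr_ge0 ?ler0n//; exact: gap_ge0.
- exact: (sqfro_direction_le n0 L0 sf minf _ track).
- exact: sqfro_gradF_diff_le.
- exact: grad_dev_le.
- by rewrite mulrCA ler_wpM2l ?ler0n//; exact: gap_quadratic_ge.
- by rewrite sumz; exact: dot_gradient_ge.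
- rewrite -[\sum_i cG i]/(sqfro G) le_eqVlt; apply/orP; left; apply/eqP; ring.
- rewrite r2 -[\sum_i cG i]/(sqfro G); apply: lerD.
    by apply: mix_le => //; exact: spread_ge0.
  by rewrite le_eqVlt; apply/orP; left; apply/eqP; ring.
- rewrite r2 -[\sum_i cD i]/(sqfro D); apply: lerD.
    by apply: mix_le => //; exact: spread_ge0.
  by rewrite le_eqVlt; apply/orP; left; apply/eqP; ring.
- by rewrite sumC; lra.
Qed.

End MeanStep.
(** * Step size and rate *)

Section StepSize.
Context {R : realType}.
Variables (n m : nat) (L lam eta : R).
Hypotheses (mn : (1 <= m <= n)%N) (L0 : 0 < L) (lam01 : 0 <= lam < 1).

Let p : R := m%:R / n%:R.
Let q : R := Num.sqrt (n%:R / m%:R).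
Let m0 : (0 : R) < m%:R. Proof. by rewrite ltr0n; case/andP: mn. Qed.
Let n0 : (0 : R) < n%:R.
Proof. by rewrite ltr0n; case/andP: mn; exact: leq_trans. Qed.

Lemma sqrt_ratioV : q = (Num.sqrt p)^-1.
Proof. by rewrite /q /p -sqrtrV ?invf_div// divr_ge0 ?ltW. Qed.

Lemma powR_ratio : (n%:R / m%:R : R) `^ (3 / 2) = q ^+ 3.
Proof.
have x0 : (0 : R) <= n%:R / m%:R by rewrite divr_ge0 ?ltW.
rewrite (_ : 3 / 2 = 2^-1 * 3%:R); last by field.
by rewrite powRrM powR12_sqrt// powR_mulrn ?sqrtr_ge0.
Qed.

Lemma sqrt_ratio_ge1 : 1 <= q.
Proof.
rewrite -[leLHS]sqrtr1 ler_wsqrtr// ler_pdivlMr// mul1r ler_nat.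
by case/andP: mn.
Qed.

Lemma stepsize_bounds : stepsize_ok n m L lam eta ->
  [/\ 0 < eta, eta * L * Num.sqrt p <= (1 - lam) ^+ 2 / 14,
      eta * L * Num.sqrt p * p <= (1 - lam) ^+ 2 / 2304 &
      eta * L * Num.sqrt p <= 1 / 576].
Proof.
rewrite /stepsize_ok /= !le_min powR_ratio -/q sqrt_ratioV.
case/and4P => eta0 h1 h2 h3.
have p0 : 0 < p by rewrite divr_gt0.
have r0 : 0 < Num.sqrt p by rewrite sqrtr_gt0.
have pE : p = Num.sqrt p ^+ 2 by rewrite sqr_sqrtr// ltW.
set r := Num.sqrt p in r0 pE h1 h2 h3 *.
have Lr : 0 <= L * r by rewrite mulr_ge0 ?ltW.
have Lr3 : 0 <= L * r ^+ 3 by rewrite mulr_ge0 ?exprn_ge0 ?ltW.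
have rn : r != 0 by rewrite gt_eqF.
have Ln : L != 0 by rewrite gt_eqF.
split => //.
- have := ler_wpM2r Lr h1; rewrite mulrA => /le_trans; apply.
  by rewrite le_eqVlt; apply/orP; left; apply/eqP; field; rewrite ?Ln ?rn.
- have := ler_wpM2r Lr3 h2; rewrite pE.
  have -> : eta * (L * r ^+ 3) = eta * L * r * r ^+ 2 by ring.
  move=> /le_trans; apply.
  by rewrite le_eqVlt; apply/orP; left; apply/eqP; field; rewrite ?Ln ?rn.
- have := ler_wpM2r Lr h3; rewrite mulrA => /le_trans; apply.
  by rewrite le_eqVlt; apply/orP; left; apply/eqP; field; rewrite ?Ln ?rn.
Qed.

(** The largest admissible step size is within a constant of the scale
    [(1 - lam)^2 sqrt (n / m) / L], because [n / m >= 1] and [1 - lam <= 1]. *)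
Lemma stepsize_exists : exists2 e : R, stepsize_ok n m L lam e &
  (1 - lam) ^+ 2 / (2304 * L) * q <= e.
Proof.
have [l0 l1] := andP lam01.
have k0 : 0 < (1 - lam) ^+ 2 by rewrite exprn_gt0// subr_gt0.
have k1 : (1 - lam) ^+ 2 <= 1.
  apply: exprn_ile1; first by rewrite subr_ge0 ltW.
  by rewrite lerBlDr lerDl.
have q1 := sqrt_ratio_ge1; have q0 : 0 < q by exact: lt_le_trans q1.
exists (Num.min ((1 - lam) ^+ 2 / (14 * L) * q)
    (Num.min ((1 - lam) ^+ 2 / (2304 * L) * q ^+ 3) (1 / (576 * L) * q))).
  rewrite /stepsize_ok /= powR_ratio -/q lexx andbT !lt_min.
  have pos a (c : nat) : 0 < a -> 0 < a / (c.+1%:R * L).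
    by move=> a0; rewrite divr_gt0// mulr_gt0// ltr0n.
  apply/and3P; split.
  - exact: (mulr_gt0 (pos _ 13 k0) q0).
  - exact: (mulr_gt0 (pos _ 2303 k0) (exprn_gt0 3 q0)).
  - exact: (mulr_gt0 (pos _ 575 ltr01) q0).
have Li : 0 < L^-1 by rewrite invr_gt0.
have c0 : 0 < L^-1 * q by rewrite mulr_gt0.
have w0 : 0 <= (1 - lam) ^+ 2 * (L^-1 * q) by rewrite mulr_ge0 ?ltW.
have w1 : (1 - lam) ^+ 2 * (L^-1 * q) <= L^-1 * q.
  by rewrite ger_pMl.
have w2 : (1 - lam) ^+ 2 * (L^-1 * q) <= (1 - lam) ^+ 2 * (L^-1 * q) * q ^+ 2.
  by rewrite ler_peMr// exprn_ege1.
rewrite !invfM !le_min; apply/and3P; split; lra.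
Qed.

End StepSize.

Section Rate.
Context {R : realType}.
Variables (n m : nat) (mu L lam eta : R).
Hypotheses (mn : (1 <= m <= n)%N) (L0 : 0 < L) (mu0 : 0 < mu).
Hypotheses (lam01 : 0 <= lam < 1).

Let p : R := m%:R / n%:R.
Let q : R := Num.sqrt (n%:R / m%:R).
Let m0 : (0 : R) < m%:R. Proof. by rewrite ltr0n; case/andP: mn. Qed.
Let n0 : (0 : R) < n%:R.
Proof. by rewrite ltr0n; case/andP: mn; exact: leq_trans. Qed.

Lemma rate_ge_descent : 1 - eta * mu * p / 2 <= rate n m mu eta.
Proof.
rewrite /rate le_max; apply/orP; left; rewrite le_eqVlt; apply/orP; left.
by apply/eqP; rewrite /p; field; rewrite gt_eqF.
Qed.

Lemma rate_ge_refresh : 1 - p / 4 <= rate n m mu eta.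
Proof.
rewrite /rate le_max; apply/orP; right; rewrite le_eqVlt; apply/orP; left.
by apply/eqP; rewrite /p; field; rewrite gt_eqF.
Qed.

Lemma rate_gt0 : 0 < rate n m mu eta.
Proof.
apply: lt_le_trans rate_ge_refresh.
have : p <= 1 by rewrite ler_pdivrMr// mul1r ler_nat; case/andP: mn.
by lra.
Qed.

Lemma rate_lt1 : 0 < eta -> rate n m mu eta < 1.
Proof.
move=> eta0; rewrite /rate gt_max !gtrBl; apply/andP; split; apply: divr_gt0.
- exact: (mulr_gt0 (mulr_gt0 eta0 mu0) m0).
- exact: (mulr_gt0 (ltr0n _ 2) n0).
- exact: m0.
- exact: (mulr_gt0 (ltr0n _ 4) n0).
Qed.

(** Whichever term attains the rate, one of the two summands compensates it: [L / mu]
    for the descent, where [eta] is replaced by its lower bound, and [n / m] for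
    the refreshing of stored gradients. *)
Lemma rate_complexity : (1 - lam) ^+ 2 / (2304 * L) * q <= eta ->
  2 <= (1 - rate n m mu eta) *
    (4 * 2304 * (L / mu * q / (1 - lam) ^+ 2 + n%:R / m%:R)).
Proof.
move=> heta; have [l0 l1] := andP lam01.
have k0 : 0 < (1 - lam) ^+ 2 by rewrite exprn_gt0// subr_gt0.
have kn : 1 - lam != 0 by rewrite gt_eqF// subr_gt0.
have nm0 : (0 : R) < n%:R / m%:R by rewrite divr_gt0.
have q0 : 0 < q by rewrite sqrtr_gt0.
have qq : q ^+ 2 = n%:R / m%:R by rewrite sqr_sqrtr// ltW.
set a := L / mu * q / (1 - lam) ^+ 2.
have a0 : 0 < a by rewrite divr_gt0// mulr_gt0// divr_gt0.
have p0 : 0 < p by rewrite divr_gt0.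
have pq : p * (n%:R / m%:R) = 1 by rewrite /p; field; rewrite !gt_eqF.
have pa : 1 <= 2304 * (eta * mu * p * a).
  have -> : 2304 * (eta * mu * p * a) =
      eta * (2304 * (L * (p * q)) / (1 - lam) ^+ 2).
    by rewrite /a; field; rewrite kn gt_eqF.
  have h0 : 0 <= 2304 * (L * (p * q)) / (1 - lam) ^+ 2.
    apply: (divr_ge0 (mulr_ge0 (ler0n _ 2304) _) (ltW k0)).
    exact: (mulr_ge0 (ltW L0) (mulr_ge0 (ltW p0) (ltW q0))).
  apply: le_trans (ler_wpM2r h0 heta).
  have -> : (1 - lam) ^+ 2 / (2304 * L) * q *
      (2304 * (L * (p * q)) / (1 - lam) ^+ 2) = p * q ^+ 2.
    by field; rewrite kn gt_eqF.
  by rewrite qq pq.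
have ema0 : 0 <= eta * mu * p.
  apply: (mulr_ge0 (mulr_ge0 _ (ltW mu0)) (ltW p0)); apply: le_trans heta.
  apply: (mulr_ge0 (divr_ge0 (ltW k0) _) (ltW q0)).
  exact: (mulr_ge0 (ler0n _ 2304) (ltW L0)).
have := mulr_ge0 ema0 (ltW nm0); have := mulr_ge0 (ltW p0) (ltW a0).
rewrite /rate.
have -> : eta * mu * m%:R / (2 * n%:R) = eta * mu * p / 2.
  by rewrite /p; field; rewrite gt_eqF.
have -> : m%:R / (4 * n%:R) = p / 4 by rewrite /p; field; rewrite gt_eqF.
move: (eta * mu * p) pa => y pa.
rewrite /Order.max; case: ifP => _ pa0 yn0; first by move: pq; lra.
by move: pa yn0; lra.
Qed.

End Rate.

(** [rho^t <= exp (- (1 - rho) t) <= eps^2], and the spare factor [eps] absorbs the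
    constant [K]. *)
Lemma geometric_le {R : realType} (rho K eps : R) (t : nat) :
  0 < rho -> 0 <= K -> 0 < eps -> K * eps <= 1 ->
  2 * ln (1 / eps) <= (1 - rho) * t%:R -> K * rho ^+ t <= eps.
Proof.
move=> rho0 K0 eps0 Keps ht.
have rho_le : rho <= expR (- (1 - rho)).
  by have := expR_ge1Dx (- (1 - rho)); lra.
have : rho ^+ t <= eps ^+ 2.
  apply: (@le_trans _ _ (expR (- (1 - rho)) ^+ t)).
    by rewrite lerXn2r// nnegrE ?expR_ge0// ltW.
  have -> : eps ^+ 2 = expR (2%:R * - ln (1 / eps)).
    by rewrite div1r lnV ?posrE// opprK expRM_natl lnK ?posrE.
  by rewrite -expRM_natl ler_expR !mulrN lerN2 [leRHS]mulrC.
move=> h; apply: le_trans (ler_wpM2l K0 h) _.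
by rewrite expr2 mulrA ger_pMl.
Qed.
(** * The iteration *)

Section Run.
Context {R : realType} {dT : measure_display} {T : measurableType dT}.
Variable P : probability T R.
Context {n d : nat}.
Variables (m : nat) (f : 'I_n -> 'rV[R]_d -> R) (L mu : R).
Variables (xs : 'rV[R]_d) (X1 : 'M[R]_(n, d)).
Variables (V : nat -> {RV P >-> {set 'I_n}}) (A B : nat -> {RV P >-> 'M[R]_n}).
Hypotheses (mn : (1 <= m <= n)%N).
Hypotheses (L0 : 0 < L) (cf : forall i, convex (f i)).
Hypotheses (sf : forall i, smooth L (f i)).
Hypotheses (mu0 : 0 < mu) (scf : strongly_convex mu (average f)).
Hypothesis minf : minimizer (average f) xs.
Hypothesis iidZ : iid P (fun k w => (V k.+1 w, A k.+1 w, B k.+1 w)).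
Hypothesis ds : forall t : nat, (1 <= t)%N ->
  {ae P, forall w, doubly_stochastic (A t w) /\ doubly_stochastic (B t w)}.
Hypothesis uniV : uniform_subset P m (V 1%N).

Let lam := Num.max (mixing P (A 1%N)) (mixing P (B 1%N)).
Hypothesis lam1 : lam < 1.

Let n0 : (0 < n)%N. Proof. by case/andP: mn; exact: leq_trans. Qed.

Let E := ({set 'I_n} * 'M[R]_n * 'M[R]_n)%type.

Let mZ k : measurable_fun setT (fun w => (V k.+1 w, A k.+1 w, B k.+1 w)).
Proof.
by apply: measurable_fun_pair; [apply: measurable_fun_pair|];
  exact: measurable_funPT.
Qed.

Let Z k : {mfun T >-> E} :=
  HB.pack (fun w => (V k.+1 w, A k.+1 w, B k.+1 w))
    (isMeasurableFun.Build _ _ _ _ _ (mZ k)).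

Definition run eta k w : ppds_state R n d :=
  ppds_run f eta X1 (V^~ w) (A^~ w) (B^~ w) k.

Lemma run_measurable eta k :
  @state_measurable R _ (past Z k) n d (run eta k).
Proof.
elim: k => [|k [mX mY mC]]; first by split; exact: mx_measurable_cst.
have lift p q (M : T -> 'M[R]_(p, q)) : @mx_measurable R _ (past Z k) _ _ M ->
    @mx_measurable R _ (past Z k.+1) _ _ M.
  by move=> mM i j; exact: measurable_fun_past (mM i j).
have mZk : measurable_fun [set: past Z k.+1] (Z k) by exact: measurable_fun_past_last.
apply: (@state_measurable_step R _ (past Z k.+1) n d f eta L L0 sf (run eta k)
   (V k.+1) (A k.+1) (B k.+1)).
- by split; exact: lift.
- exact: (measurableT_comp measurable_fst (measurableT_comp measurable_fst mZk)).
- apply: mx_measurable_of_measurable.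
  exact: (measurableT_comp measurable_snd (measurableT_comp measurable_fst mZk)).
- apply: mx_measurable_of_measurable.
  exact: (measurableT_comp measurable_snd mZk).
Qed.

Lemma ae_tracking eta k : {ae P, forall w, tracking f (run eta k w)}.
Proof.
elim: k => [|k IH]; first exact: aeW.
apply: filterS2 IH (ds (ltn0Sn k)) => w tr [_ dB].
exact: tracking_step.
Qed.

Section Contraction.
Variable eta : R.
Hypothesis oketa : stepsize_ok n m L lam eta.
Hypothesis d0 : (0 < d)%N.

Let p : R := m%:R / n%:R.
Let rho := rate n m mu eta.

Let lam01 : 0 <= lam < 1.
Proof. by rewrite lam1 andbT /lam le_max; apply/orP; left; exact: mixing_ge0. Qed.

Let U := coef_U eta L p (1 - lam).
Let cV := coef_V eta L p (1 - lam).
Let W := coef_W eta L p (1 - lam).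
Let psi := lyapunov f xs U cV W.

Let eta0 : 0 < eta. Proof. by case: (stepsize_bounds mn L0 oketa). Qed.
Let p01 : 0 < p <= 1.
Proof.
case/andP: mn => m0 hmn; rewrite divr_gt0 ?ltr0n//.
by rewrite ler_pdivrMr ?ltr0n// mul1r ler_nat.
Qed.
Let k01 : 0 < 1 - lam <= 1.
Proof. by case/andP: lam01 => l0 l1; rewrite subr_gt0 l1 lerBlDr lerDl. Qed.
Let U0 : 0 < U. Proof. exact: coef_U_gt0. Qed.
Let V0 : 0 <= cV. Proof. exact: coef_V_ge0. Qed.
Let W0 : 0 <= W. Proof. exact: coef_W_ge0. Qed.

Lemma psi_ge0 s : 0 <= psi s.
Proof. by apply: lyapunov_ge0 => //; exact: ltW. Qed.

(** Conditionally on the past the state is fixed, so the bound on the mean of one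
    step holds inside the outer integral. *)
Lemma expected_lyapunov_step k :
  (\int[P]_w (psi (run eta k.+1 w))%:E <=
   rho%:E * \int[P]_w (psi (run eta k w))%:E)%E.
Proof.
have [_ s1 s2 s3] := stepsize_bounds mn L0 oketa.
have [indep equi] := iidZ.
have mrun := run_measurable eta k.
have rho0 : 0 < rho by exact: rate_gt0.
have mpsi : measurable_fun [set: T] (fun w => psi (run eta k w)).
  move=> mT B' mB.
  have := @measurable_lyapunov R _ (past Z k) n d f L xs L0 sf U cV W
    (run eta k) mrun measurableT B' mB.
  by rewrite !setTI => /past_measurable.
pose phi (x : past Z k * E) : \bar R :=
  (psi (ppds_step f eta x.2.1.1 x.2.1.2 x.2.2 (run eta k x.1)))%:E.
have mcomp p' q (M : T -> 'M[R]_(p', q)) : @mx_measurable R _ (past Z k) _ _ M ->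
    mx_measurable (fun x : past Z k * E => M x.1).
  by move=> mM i j; exact: (measurableT_comp (mM i j) measurable_fst).
have mphi : measurable_fun setT phi.
  apply/measurable_EFinP.
  apply: (@measurable_lyapunov R _ (past Z k * E)%type n d f L xs L0 sf U cV W
    (fun x => ppds_step f eta x.2.1.1 x.2.1.2 x.2.2 (run eta k x.1))).
  apply: (@state_measurable_step R _ (past Z k * E)%type n d f eta L L0 sf
    (fun x => run eta k x.1) (fun x => x.2.1.1) (fun x => x.2.1.2) (fun x => x.2.2)).
  - by case: mrun => mX mY mC; split;
    [exact: (mcomp _ _ _ mX)|exact: (mcomp _ _ _ mY)|exact: (mcomp _ _ _ mC)].
  - exact: (measurableT_comp measurable_fst
      (measurableT_comp measurable_fst measurable_snd)).
  - apply: mx_measurable_of_measurable.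
    exact: (measurableT_comp measurable_snd
      (measurableT_comp measurable_fst measurable_snd)).
  - apply: mx_measurable_of_measurable.
    exact: (measurableT_comp measurable_snd measurable_snd).
have phi0 x : (0 <= phi x)%E by rewrite lee_fin psi_ge0.
have -> : (\int[P]_w (psi (run eta k.+1 w))%:E = \int[P]_w phi (w, Z k w))%E by [].
rewrite (@past_integral R _ T P _ E Z indep equi k phi mphi phi0).
rewrite -ge0_integralZl//; last 3 first.
- exact/measurable_EFinP.
- by move=> w _; rewrite lee_fin psi_ge0.
- by rewrite lee_fin ltW.
have mint : measurable_fun [set: T] (fun w => \int[P]_w' phi (w, Z 0%N w'))%E.
  have mF : measurable_fun [set: past Z k]
      (fun w => \int[P]_w' phi (w, Z 0%N w'))%E.
    rewrite (_ : (fun w => _) = fubini_F (distribution P (Z 0%N)) phi).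
      exact: measurable_fun_fubini_tonelli_F.
    apply/funext => w; rewrite /fubini_F ge0_integral_distribution//.
    by apply: measurableT_comp => //; exact: measurable_pair1.
  move=> mT B' mB; have := mF measurableT B' mB; rewrite !setTI.
  by move=> /past_measurable.
apply: ae_ge0_le_integral => //.
- by move=> w _; exact: integral_ge0.
- by move=> w _; rewrite -EFinM lee_fin mulr_ge0 ?psi_ge0// ltW.
- by apply: measurable_funeM; exact/measurable_EFinP.
apply: filterS (ae_tracking eta k) => w tr _; rewrite -EFinM.
have rho_a := rate_ge_descent mu eta mn; have rho_c := rate_ge_refresh mu eta mn.
exact: (mean_lyapunov_step mn d0 L0 cf sf mu0 scf minf (ds (ltn0Sn 0)) uniV lam1
  eta0 s1 s2 s3 rho_a rho_c tr).
Qed.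

Lemma expected_lyapunov_le k :
  (\int[P]_w (psi (run eta k w))%:E <=
   (rho ^+ k * psi (PPDSState X1 (gradientF f X1) X1))%:E)%E.
Proof.
elim: k => [|k IH].
  by rewrite expr0 mul1r -[leRHS](integral_cst_probability P).
apply: le_trans (expected_lyapunov_step k) _.
rewrite exprS -mulrA EFinM lee_wpmul2l// lee_fin ltW//.
exact: rate_gt0.
Qed.

Lemma error_bound_pos_dim : exists2 K : R, 0 <= K &
  forall (i : 'I_n) (t : nat), (1 <= t)%N ->
  (ppds_error P f eta X1 V A B xs i t <= (K * rho ^+ t)%:E)%E.
Proof.
have rho0 : 0 < rho by exact: rate_gt0.
have C0 : 0 <= 1 + U^-1 by rewrite addr_ge0 ?invr_ge0// ltW.
pose psi1 := psi (PPDSState X1 (gradientF f X1) X1).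
exists ((1 + U^-1) * psi1 / rho).
  by rewrite divr_ge0 ?(ltW rho0)// mulr_ge0 ?psi_ge0.
move=> i [//|t] _; rewrite /ppds_error unlock /ppds_X /=.
have mX : mx_measurable (fun w => st_X (run eta t w)).
  have [mX _ _] := run_measurable eta t.
  move=> a b mT B' mB; have := mX a b measurableT B' mB; rewrite !setTI.
  by move=> /past_measurable.
have mpsi : measurable_fun [set: T] (fun w => psi (run eta t w)).
  move=> mT B' mB.
  have := @measurable_lyapunov R _ (past Z t) n d f L xs L0 sf U cV W
    (run eta t) (run_measurable eta t) measurableT B' mB.
  by rewrite !setTI => /past_measurable.
apply: (@le_trans _ _ (\int[P]_w ((1 + U^-1)%:E * (psi (run eta t w))%:E))%E).
  apply: ge0_le_integral => //.
  - by move=> w _; rewrite lee_fin sqr_ge0.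
  - apply/measurable_EFinP; under eq_fun do rewrite norm2_sqr.
    apply/measurable_sqn/mx_measurableB; last exact: mx_measurable_cst.
    exact: mx_measurable_row.
  - by apply: measurable_funeM; exact/measurable_EFinP.
  - by move=> w _; rewrite -EFinM lee_fin norm2_sqr sqn_row_le_lyapunov.
rewrite ge0_integralZl//; last 2 first.
- exact/measurable_EFinP.
- by move=> w _; rewrite lee_fin psi_ge0.
have -> : (1 + U^-1) * psi1 / rho * rho ^+ t.+1 = (1 + U^-1) * (rho ^+ t * psi1).
  by rewrite exprS; field; rewrite !gt_eqF.
by rewrite EFinM lee_wpmul2l// expected_lyapunov_le.
Qed.

End Contraction.

(** In dimension 0 nothing compares [mu] with [L], but there the error vanishes. *)
Lemma error_bound eta : stepsize_ok n m L lam eta -> exists2 K : R, 0 <= K &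
  forall (i : 'I_n) (t : nat), (1 <= t)%N ->
  (ppds_error P f eta X1 V A B xs i t <= (K * rate n m mu eta ^+ t)%:E)%E.
Proof.
move=> ok; have [d0|d0] := posnP d; last exact: error_bound_pos_dim.
exists 0 => // i t _; rewrite mul0r /ppds_error unlock.
under eq_integral do rewrite norm2_sqr.
rewrite integral0_eq// => w _; congr EFin; rewrite /sqn /dot big1// => -[j jd].
by exfalso; rewrite d0 in jd.
Qed.
End Run.

Theorem theorem2 (R : realType) :
  exists Cuniv : R, 0 < Cuniv /\
  forall (dsp : measure_display) (Omega : measurableType dsp)
    (P : probability Omega R)
    (n m d : nat) (e : rel 'I_n)
    (f : 'I_n -> 'rV[R]_d -> R) (L mu : R) (xstar : 'rV[R]_d)
    (X1 : 'M[R]_(n, d))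
    (V : nat -> {RV P >-> {set 'I_n}})
    (A B : nat -> {RV P >-> 'M[R]_n}),
  let lambda := Num.max (mixing P (A 1%N)) (mixing P (B 1%N)) in
  (forall t : nat, (1 <= t)%N ->
     {ae P, forall w, compatible e (A t w) /\ compatible e (B t w)}) ->
  0 < L -> (forall i, convex (f i)) -> (forall i, smooth L (f i)) ->
  0 < mu -> strongly_convex mu (average f) -> minimizer (average f) xstar ->
  iid P (fun k w => (V k.+1 w, A k.+1 w, B k.+1 w)) ->
  (forall t : nat, (1 <= t)%N ->
     {ae P, forall w, doubly_stochastic (A t w) /\ doubly_stochastic (B t w)}) ->
  lambda < 1 ->
  (1 <= m <= n)%N ->
  (forall t : nat, (1 <= t)%N -> uniform_subset P m (V t)) ->
  (forall eta : R, stepsize_ok n m L lambda eta ->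
     forall i : 'I_n, exists K : R, forall t : nat, (1 <= t)%N ->
       (ppds_error P f eta X1 V A B xstar i t <=
          (K * rate n m mu eta ^+ t)%:E)%E) /\
  (exists eta : R, stepsize_ok n m L lambda eta /\
     \forall eps \near (0 : R)^'+, forall (i : 'I_n) (t : nat), (1 <= t)%N ->
       Cuniv * (L / mu * Num.sqrt (n%:R / m%:R) / (1 - lambda) ^+ 2
                + n%:R / m%:R) * ln (1 / eps) <= t%:R ->
       (ppds_error P f eta X1 V A B xstar i t <= eps%:E)%E).
Proof.
(* 2304 is the largest constant of the step-size condition; one factor 2 comes from
   the half in the descent rate, the other from reaching [eps^2] *)
exists (4 * 2304); split; first exact: (mulr_gt0 (ltr0n _ 4) (ltr0n _ 2304)).
move=> dsp Omega P n m d e f L mu xs X1 V A B lambda _ L0 cf sf mu0 scf minf.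
move=> iidZ ds lam1 mn uniV; have uniV1 := uniV 1%N isT.
have bound eta := error_bound X1 mn L0 cf sf mu0 scf minf iidZ ds uniV1 lam1 (eta := eta).
split=> [eta /bound[K _ hK] i|]; first by exists K => t; exact: hK.
have lam01 : 0 <= lambda < 1.
  rewrite lam1 andbT /lambda le_max; apply/orP; left; apply: mixing_ge0.
  by case/andP: mn; exact: leq_trans.
have [eta ok eta_ge] := stepsize_exists mn L0 lam01.
exists eta; split => //; have [K K0 hK] := bound eta ok.
have rate2 := rate_complexity mn L0 mu0 lam01 eta_ge.
set N := 4 * 2304 * _ in rate2 *.
have rho0 := rate_gt0 mu eta mn.
near=> eps => i t t1 ht; apply: le_trans (hK i t t1) _; rewrite lee_fin.
have eps0 : 0 < eps by near: eps; exact: nbhs_right_gt.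
have eps1 : eps < 1 by near: eps; exact: nbhs_right_lt.
have epsK : eps < (K + 1)^-1.
  by near: eps; apply: nbhs_right_lt; rewrite invr_gt0 ltr_wpDl.
apply: geometric_le => //.
  have K1 : 0 < K + 1 by rewrite ltr_wpDl.
  have : (K + 1) * eps <= 1.
    by rewrite -ler_pdivlMl// mulr1 ltW.
  by lra.
have ln0 : 0 <= ln (1 / eps).
  by rewrite ln_ge0// ler_pdivlMr// mul1r ltW.
have N1 : 0 < 1 - rate n m mu eta.
  rewrite subr_gt0; apply: (rate_lt1 mn mu0).
  by have [] := stepsize_bounds mn L0 ok.
apply: (@le_trans _ _ ((1 - rate n m mu eta) * N * ln (1 / eps))).
  by rewrite ler_wpM2r.
by rewrite -mulrA ler_pM2l.
Unshelve. all: by end_near.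
Qed.
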